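(* Let $\Bbbk$ be a field of characteristic zero and let $A$ and $B$ be (nonzero, unital) associative $\Bbbk$-algebras. Then the free product $A*B$ is trace-RFD if and only if both $A$ and $B$ are trace-RFD.
   Context: An algebra means a nonzero associative unital $\Bbbk$-algebra. A finite-dimensional representation of an algebra $C$ is a unital $\Bbbk$-algebra homomorphism $\rho\colon C\to\operatorname{End}_{\Bbbk}(V)$ with $V$ a nonzero finite-dimensional $\Bbbk$-vector space. An algebra $C$ is residually finite-dimensional (RFD) if for every nonzero $c\in C$ there is a finite-dimensional representation $\rho$ of $C$ with $\rho(c)\neq0$. The cocenter of $C$ is the vector space $C_{\natural}:=C/[C,C]$, where $[C,C]$ is the $\Bbbk$-linear span of all commutators $xy-yx$ with $x,y\in C$; the class of $c\in C$ is denoted $\overline c$. Each finite-dimensional representation $\rho$ induces a linear functional $\operatorname{tr}(-)(\rho)\colon C_{\natural}\to\Bbbk$, $\overline c\mapsto\operatorname{tr}(\rho(c))$. An algebra $C$ is trace residually finite-dimensional (trace-RFD) if it is RFD and, in addition, for every nonzero $\overline c\in C_{\natural}$ there is a finite-dimensional representation $\rho$ of $C$ with $\operatorname{tr}(\overline c)(\rho)\neq0$. The free product $A*B$ is the coproduct of $A$ and $B$ in the category of unital $\Bbbk$-algebras. *)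

(* Defs.v *)
From HB Require Import structures.
From mathcomp Require Import all_boot all_order all_algebra.
From mathcomp Require Import generic_quotient ring_quotient.
From mathcomp Require Import boolp.

Set Implicit Arguments.
Unset Strict Implicit.
Unset Printing Implicit Defensive.

Import GRing.Theory passmx.
Local Open Scope ring_scope.
Local Open Scope quotient_scope.

(* [algType K] already requires 1 != 0, so its inhabitants are exactly the
   nonzero associative unital K-algebras. *)

Record fdrep (K : fieldType) (C : algType K) := FdRep {
  rep_space : vectType K;
  rep_map :> {linear C -> 'End(rep_space)};
  rep_nonzero : (0 < \dim {:rep_space})%N;
  rep_map1 : rep_map 1 = \1%VF;
  rep_mapM : forall x y : C, rep_map (x * y) = (rep_map x \o rep_map y)%VF
}.

Definition endtr (K : fieldType) (V : vectType K) (f : 'End(V)) : K :=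
  \tr (mxof (vbasis {:V}) (vbasis {:V}) f).

Lemma endtr_linear (K : fieldType) (V : vectType K) : linear_for *%R (@endtr K V).
Proof. by move=> a f g; rewrite /endtr linearP mxtraceD mxtraceZ. Qed.

HB.instance Definition _ (K : fieldType) (V : vectType K) :=
  GRing.isLinear.Build K 'End(V) K *%R (@endtr K V) (@endtr_linear K V).

Lemma endtr_comp (K : fieldType) (V : vectType K) (f g : 'End(V)) :
  endtr (f \o g)%VF = endtr (g \o f)%VF.
Proof.
by rewrite /endtr !(@mxof_comp _ _ _ _ _ (vbasis {:V})) ?vbasisP // mxtrace_mulC.
Qed.

Definition commutator (K : fieldType) (C : algType K) (p : C * C) : C :=
  p.1 * p.2 - p.2 * p.1.

(* The subspace [C, C], as a boolean predicate (via classical logic) so that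
   the library's quotients by additive subgroups apply. *)
Definition comm_space (K : fieldType) (C : algType K) : {pred C} :=
  fun c => `[< exists s : seq (K * (C * C)),
                 c = \sum_(t <- s) t.1 *: commutator t.2 >].
Arguments comm_space {K} C _.

Section Cocenter.
Variables (K : fieldType) (C : algType K).

Lemma comm_spaceP (c : C) :
  reflect (exists s : seq (K * (C * C)),
             c = \sum_(t <- s) t.1 *: commutator t.2)
          (c \in comm_space C).
Proof. exact: asboolP. Qed.

Lemma comm_spaceZD (a : K) (x y : C) :
  x \in comm_space C -> y \in comm_space C -> a *: x + y \in comm_space C.
Proof.
move=> /comm_spaceP[s ->] /comm_spaceP[t ->]; apply/comm_spaceP.
exists ([seq (a * u.1, u.2) | u <- s] ++ t).
rewrite big_cat big_map scaler_sumr; congr (_ + _).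
by apply: eq_bigr => u _; rewrite scalerA.
Qed.

Lemma comm_space0 : 0 \in comm_space C.
Proof. by apply/comm_spaceP; exists [::]; rewrite big_nil. Qed.

Lemma comm_space_zmod_closed : zmod_closed (comm_space C).
Proof.
split=> [|x y Cx Cy]; first exact: comm_space0.
by rewrite addrC -scaleN1r; apply: comm_spaceZD.
Qed.

HB.instance Definition _ :=
  GRing.isZmodClosed.Build C (comm_space C) comm_space_zmod_closed.

Definition cocenter : Type := Quotient.quot (comm_space C).

HB.instance Definition _ := GRing.Zmodule.on cocenter.
HB.instance Definition _ := Quotient.on cocenter.

Definition cocls (c : C) : cocenter := \pi_cocenter c.

Lemma coclsP (x y : C) : reflect (cocls x = cocls y) (x - y \in comm_space C).
Proof.
by rewrite Quotient.idealrBE; apply: eqP.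
Qed.

Lemma coclsK (u : cocenter) : cocls (repr u) = u.
Proof. exact: reprK. Qed.

Lemma cocls_is_zmod_morphism : zmod_morphism cocls.
Proof. exact: (raddfB (\pi_(Quotient.quot (comm_space C)))). Qed.

HB.instance Definition _ :=
  GRing.isZmodMorphism.Build C cocenter cocls cocls_is_zmod_morphism.

Lemma cocls_eq0 (c : C) : (cocls c == 0) = (c \in comm_space C).
Proof.
by rewrite -[in RHS](subr0 c) -(raddf0 cocls); apply/eqP/coclsP.
Qed.

Definition cocenter_scale (a : K) (u : cocenter) : cocenter :=
  cocls (a *: repr u).

Lemma cocenter_scaleE (a : K) (c : C) :
  cocenter_scale a (cocls c) = cocls (a *: c).
Proof.
apply/coclsP; rewrite -scalerBr -[X in X \in _]addr0.
by apply: comm_spaceZD comm_space0; apply/coclsP; rewrite coclsK.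
Qed.

Fact cocenter_scaleA a b u :
  cocenter_scale a (cocenter_scale b u) = cocenter_scale (a * b) u.
Proof. by rewrite -[u]coclsK !cocenter_scaleE scalerA. Qed.

Fact cocenter_scale1 : left_id 1 cocenter_scale.
Proof. by move=> u; rewrite -[u]coclsK cocenter_scaleE scale1r. Qed.

Fact cocenter_scaleDr : right_distributive cocenter_scale +%R.
Proof.
move=> a u v; rewrite -[u]coclsK -[v]coclsK -raddfD !cocenter_scaleE.
by rewrite scalerDr raddfD.
Qed.

Fact cocenter_scaleDl u : {morph cocenter_scale^~ u : a b / a + b}.
Proof. by move=> a b; rewrite -[u]coclsK !cocenter_scaleE scalerDl raddfD. Qed.

HB.instance Definition _ := GRing.Zmodule_isLmodule.Build K cocenter
  cocenter_scaleA cocenter_scale1 cocenter_scaleDr cocenter_scaleDl.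

Lemma cocls_is_scalable : scalable cocls.
Proof. by move=> a c; rewrite -cocenter_scaleE. Qed.

HB.instance Definition _ :=
  GRing.isScalable.Build K C cocenter *:%R cocls cocls_is_scalable.

(* The functional induced by the trace of [rho]; by [cotrE] its value does not
   depend on the representative. *)
Definition cotr (rho : fdrep C) (u : cocenter) : K := endtr (rho (repr u)).

Lemma endtr_comm_space (rho : fdrep C) (c : C) :
  c \in comm_space C -> endtr (rho c) = 0.
Proof.
move=> /comm_spaceP[s ->]; rewrite !linear_sum big1 // => t _.
by rewrite !linearZ /= /commutator !linearB /= !rep_mapM endtr_comp subrr mulr0.
Qed.

Lemma cotrE (rho : fdrep C) (c : C) : cotr rho (cocls c) = endtr (rho c).
Proof.
apply/eqP; rewrite -subr_eq0 /cotr -!linearB /=; apply/eqP.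
by apply: endtr_comm_space; apply/coclsP; rewrite coclsK.
Qed.

Lemma cotr_linear (rho : fdrep C) : linear_for *%R (cotr rho).
Proof.
move=> a u v; rewrite -[u]coclsK -[v]coclsK -linearP !cotrE.
by rewrite !linearP.
Qed.

HB.instance Definition _ (rho : fdrep C) :=
  GRing.isLinear.Build K cocenter K *%R (cotr rho) (cotr_linear rho).

Definition RFD : Prop :=
  forall c : C, c != 0 -> exists rho : fdrep C, rho c != 0.

Definition trace_RFD : Prop :=
  RFD /\ forall u : cocenter, u != 0 -> exists rho : fdrep C, cotr rho u != 0.

End Cocenter.

(* [P], together with [iA] and [iB], is a coproduct of [A] and [B] in the
   category of (nonzero) unital K-algebras. *)
Definition is_free_product (K : fieldType) (A B P : algType K)
    (iA : {lrmorphism A -> P}) (iB : {lrmorphism B -> P}) : Prop :=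
  forall (T : algType K) (f : {lrmorphism A -> T}) (g : {lrmorphism B -> T}),
    exists h : {lrmorphism P -> T},
      [/\ h \o iA =1 f, h \o iB =1 g &
          forall h' : {lrmorphism P -> T},
            h' \o iA =1 f -> h' \o iB =1 g -> h' =1 h].

(* Main.v *)
(* If [P] is trace-RFD, a representation of [B] of dimension [d] gives a morphism
   [P -> M_d(A)] that is scalar on [A]; followed by the trace [M_d(A) -> A/[A,A]] it
   is multiplication by [d] on [A/[A,A]], so that [A] and its cocenter embed in [P]
   and in the cocenter of [P].

   Conversely, let [E] be an endomorphism of square zero of a representation of
   both [A] and [B], and let [B] act through its conjugate by [1 + tE]. The top
   coefficient in [t] of the trace of [a1 b1 ... an bn] is, up to sign, the trace of
   [a1 E b1 E ... an E bn E]. Writing [E = U Q] with [Q U = 0], this is the trace of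
   the product of the matrices [Q a U] and [Q b U], and these can be made arbitrary
   families of coefficient functionals vanishing at [1]. Weighted cyclic permutation
   matrices then give the sum over the rotations of a product of functionals. If all
   those sums vanish on a combination [p] of such words, then the sum of the
   rotations of [p], which is [n p] modulo commutators, is a combination of shorter
   words; as [n] is invertible, one concludes by induction on [n], down to the case
   of [a + b], settled by tensor products of representations. The entries of
   [Q p U], with path matrices instead of cycles, show in the same way that [P] is
   RFD. *)
Require Import Defs.
From HB Require Import structures.
From mathcomp Require Import all_boot all_order all_algebra.
From mathcomp Require Import boolp mxtens.

Set Implicit Arguments.
Unset Strict Implicit.
Unset Printing Implicit Defensive.

Import GRing.Theory passmx.
Local Open Scope ring_scope.

(** * Matrix representations *)

Definition mrep (K : fieldType) (S : nzRingType) (sc : K -> S) (C : algType K)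
    (d : nat) (f : C -> 'M[S]_d) : Prop :=
  [/\ forall c x y, f (c *: x + y) = sc c *: f x + f y,
      f 1 = 1%:M & forall x y, f (x * y) = f x *m f y].

Section MrepTheory.
Variables (K : fieldType) (S : nzRingType) (sc : K -> S) (C : algType K).
Variables (d : nat) (f : C -> 'M[S]_d).
Hypotheses (sc1 : sc 1 = 1) (rf : mrep sc f).

Lemma mrepD x y : f (x + y) = f x + f y.
Proof. by have [/(_ 1 x y) + _ _] := rf; rewrite scale1r sc1 scale1r. Qed.

Lemma mrep0 : f 0 = 0.
Proof. by apply: (addIr (f 0)); rewrite -mrepD !add0r. Qed.

Lemma mrepZ c x : f (c *: x) = sc c *: f x.
Proof. by have [/(_ c x 0) + _ _] := rf; rewrite mrep0 !addr0. Qed.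

Lemma mrepB x y : f (x - y) = f x - f y.
Proof. by apply: (addIr (f y)); rewrite -mrepD !subrK. Qed.

Lemma mrep_sum (I : Type) (r : seq I) (F : I -> C) :
  f (\sum_(i <- r) F i) = \sum_(i <- r) f (F i).
Proof. exact: (big_morph f mrepD mrep0). Qed.

Lemma mrep_comp (C' : algType K) (g : {lrmorphism C' -> C}) : mrep sc (f \o g).
Proof.
have [fL f1 fM] := rf.
by split=> [c x y||x y] /=; rewrite ?linearP ?fL ?rmorph1 ?rmorphM ?fM.
Qed.

End MrepTheory.

(* Matrices over a K-algebra, as a K-algebra: the library only gives
   [R]-module structures to ['M[R]_n]. *)
Definition mxalg (K : fieldType) (R : algType K) (n : nat) : Type := 'M[R]_n.+1.

Section MxAlg.
Variables (K : fieldType) (R : algType K) (n : nat).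
Local Notation T := (mxalg R n).

HB.instance Definition _ := GRing.NzRing.on T.

Definition mxalg_scale (c : K) (M : T) : T := c%:A *: (M : 'M[R]_n.+1).

Fact mxalg_scaleA a b M : mxalg_scale a (mxalg_scale b M) = mxalg_scale (a * b) M.
Proof. by rewrite /mxalg_scale scalerA -scalerAl mul1r scalerA. Qed.

Fact mxalg_scale1 : left_id 1 mxalg_scale.
Proof. by move=> M; rewrite /mxalg_scale scale1r scale1r. Qed.

Fact mxalg_scaleDr : right_distributive mxalg_scale +%R.
Proof. by move=> a M N; rewrite /mxalg_scale scalerDr. Qed.

Fact mxalg_scaleDl M : {morph mxalg_scale^~ M : a b / a + b}.
Proof. by move=> a b; rewrite /mxalg_scale !scalerDl. Qed.

HB.instance Definition _ := GRing.Zmodule_isLmodule.Build K T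
  mxalg_scaleA mxalg_scale1 mxalg_scaleDr mxalg_scaleDl.

Fact mxalg_scaleAl (c : K) (M N : T) : c *: (M * N) = (c *: M) * N.
Proof. exact: (scalemxAl c%:A (M : 'M[R]_n.+1) N). Qed.

HB.instance Definition _ := GRing.Lmodule_isLalgebra.Build K T mxalg_scaleAl.

Fact mxalg_scaleAr (c : K) (M N : T) : c *: (M * N) = M * (c *: N).
Proof.
apply/matrixP=> i j; rewrite [LHS]mxE [X in _ * X]mxE [RHS]mxE mulr_sumr.
apply: eq_bigr => k _; rewrite [X in _ = _ * X]mxE.
by rewrite -!scalerAl !mul1r scalerAr.
Qed.

HB.instance Definition _ := GRing.Lalgebra_isAlgebra.Build K T mxalg_scaleAr.

End MxAlg.

Lemma lrmorphism_of (K : fieldType) (C D : algType K) (f : C -> D) :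
    (forall c x y, f (c *: x + y) = c *: f x + f y) -> f 1 = 1 ->
    (forall x y, f (x * y) = f x * f y) ->
  exists h : {lrmorphism C -> D}, h =1 f.
Proof.
move=> fL f1 fM.
pose linM := GRing.isLinear.Build K C D *:%R f fL.
pose mulM := GRing.isMonoidMorphism.Build C D f (f1, fM).
pose h : {lrmorphism C -> D} := HB.pack f linM mulM.
by exists h.
Qed.

(** * The universal property: matrix representations and generation *)

Section FreeProduct.
Variables (K : fieldType) (A B P : algType K).
Variables (iA : {lrmorphism A -> P}) (iB : {lrmorphism B -> P}).
Hypothesis freeP : is_free_product iA iB.

Lemma free_product_mrep (R : algType K) d (al : A -> 'M[R]_d) (be : B -> 'M[R]_d) :
    mrep (fun c => c%:A) al -> mrep (fun c => c%:A) be ->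
  exists2 h : P -> 'M[R]_d, mrep (fun c => c%:A) h &
    (forall a, h (iA a) = al a) /\ (forall b, h (iB b) = be b).
Proof.
(* Matrices of size 0 form the zero ring, which is no [algType], so the universal property only
   applies from size 1 on. *)
case: d al be => [|n] al be [aL a1 aM] [bL b1 bM].
  exists (fun=> 0); last by split=> ?; apply/matrixP=> -[].
  by split=> *; apply/matrixP=> -[].
have [f fE] := @lrmorphism_of K A (mxalg R n) al aL a1 aM.
have [g gE] := @lrmorphism_of K B (mxalg R n) be bL b1 bM.
have [h [hA hB _]] := freeP f g.
exists h; first by split=> *; rewrite ?linearP ?rmorph1 ?rmorphM.
by split=> x; rewrite -?fE -?gE; [apply: hA | apply: hB].
Qed.

Lemma free_product_sym : is_free_product iB iA.
Proof.
move=> T f g; have [h [hg hf hU]] := freeP g f.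
by exists h; split=> // h' h'f h'g; apply: hU.
Qed.

Section Generation.
Variable S : {pred P}.
Hypothesis S_subalg : subalg_closed S.
Hypotheses (SA : forall a, iA a \in S) (SB : forall b, iB b \in S).

HB.instance Definition _ := GRing.isSubalgClosed.Build K P S S_subalg.
Let subS : Type := {p : P | p \in S}.
HB.instance Definition _ := SubChoice.on subS.
HB.instance Definition _ := [SubChoice_isSubAlgebra of subS by <:].

(** [iA] and [iB] factor through the subalgebra; the composite of [P -> S] with the inclusion fixes
    both images pointwise, hence is the identity by uniqueness. *)
Lemma free_product_gen p : p \in S.
Proof.
have [f fE] : exists f : {lrmorphism A -> subS}, forall a, val (f a) = iA a.
  have [|||f fE] := @lrmorphism_of K A subS (fun a => exist _ (iA a) (SA a)).
  - by move=> c x y; apply: val_inj; rewrite /= !linearP.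
  - by apply: val_inj; rewrite /= !rmorph1.
  - by move=> x y; apply: val_inj; rewrite /= !rmorphM.
  by exists f => a; rewrite fE.
have [g gE] : exists g : {lrmorphism B -> subS}, forall b, val (g b) = iB b.
  have [|||g gE] := @lrmorphism_of K B subS (fun b => exist _ (iB b) (SB b)).
  - by move=> c x y; apply: val_inj; rewrite /= !linearP.
  - by apply: val_inj; rewrite /= !rmorph1.
  - by move=> x y; apply: val_inj; rewrite /= !rmorphM.
  by exists g => b; rewrite gE.
have [h [hA hB _]] := freeP f g.
have [k [_ _ kU]] := freeP iA iB.
have [|||e eE] := @lrmorphism_of K P P (fun p => val (h p)).
- by move=> c x y; rewrite !linearP.
- by rewrite !rmorph1.
- by move=> x y; rewrite !rmorphM.
have eA : e \o iA =1 iA by move=> a; rewrite /= eE -[RHS]fE; congr val; apply: hA.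
have eB : e \o iB =1 iB by move=> b; rewrite /= eE -[RHS]gE; congr val; apply: hB.
have -> : p = e p by rewrite (kU e eA eB) -(kU idfun).
by rewrite eE; apply: valP.
Qed.

End Generation.

End FreeProduct.

(** * Finite-dimensional representations and matrix representations *)

Lemma mrep_of_fdrep (K : fieldType) (C : algType K) (rho : fdrep C) :
  exists d (f : C -> 'M[K]_d),
    [/\ (0 < d)%N, mrep id f, forall c, \tr (f c) = endtr (rho c) &
        forall c, f c = 0 -> rho c = 0].
Proof.
set b := vbasis {:rep_space rho}; have bP : basis_of _ b := vbasisP _.
(* [mxof] follows the row-vector convention and reverses composition; transposing restores the
   order. *)
exists (\dim {:rep_space rho}), (fun c => (mxof b b (rho c))^T).
split=> [||c|c]; first exact: rep_nonzero.
- split=> [k x y||x y]; first by rewrite !linearP.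
    by rewrite rep_map1 mxof1 ?(basis_free bP) // trmx1.
  by rewrite rep_mapM (@mxof_comp _ _ _ _ _ b) ?vbasisP // trmx_mul.
- by rewrite mxtrace_tr.
by move/(congr1 trmx); rewrite trmxK trmx0 => /eqP; rewrite (mxof_eq0 bP) // => /eqP.
Qed.

(** Matrix units: [delta_mx i 0 *m delta_mx 0 i] commutes round to [delta_mx 0 0], and for [i != j]
    the product [delta_mx i i *m delta_mx i j] is zero in the other order. *)
Lemma trace_functional_mx (K : fieldType) d (phi : {linear 'M[K]_d.+1 -> K | *%R}) :
    (forall M N, phi (M *m N) = phi (N *m M)) ->
  forall M, phi M = phi (delta_mx 0 0) * \tr M.
Proof.
move=> phiC M; have phiii i : phi (delta_mx i i) = phi (delta_mx 0 0).
  by rewrite -(mul_delta_mx (ord0 : 'I_d.+1) i i) phiC mul_delta_mx.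
have phiij i j : i != j -> phi (delta_mx i j) = 0.
  by move=> ij; rewrite -(mul_delta_mx i i j) phiC mul_delta_mx_0 ?linear0 // eq_sym.
rewrite {1}[M]matrix_sum_delta linear_sum mulr_sumr; apply: eq_bigr => i _.
rewrite linear_sum (bigD1 i) //= big1 => [|j ji].
  by rewrite addr0 linearZ phiii mulrC.
by rewrite linearZ /= phiij ?mulr0 // eq_sym.
Qed.

Section FdrepOfMrep.
Variables (K : fieldType) (charK0 : [pchar K] =i pred0).

Definition mxend d (M : 'M[K]_d) : 'End('cV[K]_d) := linfun (mulmx M).

Lemma mxendE d (M : 'M[K]_d) v : mxend M v = M *m v.
Proof. by rewrite lfunE. Qed.

Lemma mxend_linear d : linear (@mxend d).
Proof.
move=> a M N; apply/lfunP=> v.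
by rewrite add_lfunE scale_lfunE !mxendE mulmxDl scalemxAl.
Qed.

Lemma mxend_mul d (M N : 'M[K]_d) : mxend (M *m N) = (mxend M \o mxend N)%VF.
Proof. by apply/lfunP=> v; rewrite comp_lfunE !mxendE mulmxA. Qed.

Lemma mxend_scalar1 d : mxend (1%:M : 'M[K]_d) = \1%VF.
Proof. by apply/lfunP=> v; rewrite mxendE id_lfunE mul1mx. Qed.

Lemma mxend_eq0 d (M : 'M[K]_d) : mxend M = 0 -> M = 0.
Proof.
move=> M0; apply/matrixP=> i j; have := mxendE M (delta_mx j 0).
by rewrite M0 lfunE -colE => /matrixP/(_ i 0); rewrite !mxE.
Qed.

Lemma dim_cV d : \dim {:'cV[K]_d} = d.
Proof. by rewrite dimvf /dim /= muln1. Qed.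

(** [endtr] is computed in the opaque basis [vbasis], so the two traces are compared abstractly:
    tracial functionals on matrices are proportional, and the identity fixes the factor since its
    trace is invertible in characteristic 0. *)
Lemma endtr_mxend d (M : 'M[K]_d) : endtr (mxend M) = \tr M.
Proof.
case: d M => [|d] M.
  rewrite (_ : M = 0); last by apply/matrixP=> -[].
  have -> : mxend (0 : 'M[K]_0) = 0.
    by apply/lfunP=> v; rewrite mxendE mul0mx lfunE.
  by rewrite !linear0.
pose endtr_mx (N : 'M[K]_d.+1) : K := endtr (mxend N).
have phiL : linear_for *%R endtr_mx.
  by move=> a x y; rewrite /endtr_mx mxend_linear linearP.
pose phim := GRing.isLinear.Build K 'M[K]_d.+1 K *%R endtr_mx phiL.
pose phi : {linear 'M[K]_d.+1 -> K | *%R} := HB.pack endtr_mx phim.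
have phiC M1 N1 : phi (M1 *m N1) = phi (N1 *m M1).
  by rewrite /= /endtr_mx !mxend_mul endtr_comp.
have phiE := trace_functional_mx phiC.
have d0 : d.+1%:R != 0 :> K by rewrite (iffLR (pcharf0P _) charK0).
have c1 : phi (delta_mx 0 0) = 1.
  apply: (mulIf d0); rewrite -mxtrace1 -phiE mul1r /= /endtr_mx mxend_scalar1.
  by rewrite /endtr mxof1 ?(basis_free (vbasisP _)) // !mxtrace1 dim_cV.
by have := phiE M; rewrite c1 mul1r.
Qed.

Lemma fdrep_of_mrep (C : algType K) d (f : C -> 'M[K]_d) :
    (0 < d)%N -> mrep id f ->
  exists rho : fdrep C, (forall c, endtr (rho c) = \tr (f c)) /\
    (forall c, rho c = 0 -> f c = 0).
Proof.
move=> d0 [fL f1 fM]; pose mxendf c := mxend (f c).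
have rL : linear mxendf by move=> a x y; rewrite /mxendf fL mxend_linear.
pose rm := GRing.isLinear.Build K C 'End('cV[K]_d) *:%R mxendf rL.
pose r : {linear C -> 'End('cV[K]_d)} := HB.pack mxendf rm.
have V0 : (0 < \dim {:'cV[K]_d})%N by rewrite dim_cV.
have r1 : r 1 = \1%VF by rewrite /= /mxendf f1 mxend_scalar1.
have rM x y : r (x * y) = (r x \o r y)%VF by rewrite /= /mxendf fM mxend_mul.
exists (FdRep V0 r1 rM); split=> c /=; first exact: endtr_mxend.
exact: mxend_eq0.
Qed.

Lemma RFDP (C : algType K) :
  RFD C <-> forall c : C, (forall d (f : C -> 'M[K]_d), mrep id f -> f c = 0) -> c = 0.
Proof.
split=> [rfd c c0|sep c c0].
  apply/eqP/negPn/negP=> /rfd[rho /eqP]; apply.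
  by have [d [f [_ rf _ +]]] := mrep_of_fdrep rho; apply; apply: c0.
apply: contrapT => nrho; move/eqP: c0; apply; apply: sep => -[|d] f rf.
  by apply/matrixP=> -[].
have [//|rho [_ rf0]] := fdrep_of_mrep _ rf; apply: rf0.
by apply/eqP/negPn/negP=> rc; apply: nrho; exists rho.
Qed.

Definition trace_null (C : algType K) (c : C) :=
  forall d (f : C -> 'M[K]_d), mrep id f -> \tr (f c) = 0.

Lemma trace_RFDP (C : algType K) :
  trace_RFD C <-> RFD C /\ forall c : C, trace_null c -> c \in comm_space C.
Proof.
split=> -[rfd sep]; split=> //; [move=> c c0 | move=> u u0].
  rewrite -cocls_eq0; apply/negPn/negP=> /sep[rho]; rewrite cotrE => /eqP; apply.
  by have [d [f [_ rf <- _]]] := mrep_of_fdrep rho; apply: c0.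
apply: contrapT => nrho; move: u0; rewrite -(coclsK u) cocls_eq0 => /negP; apply.
apply: sep => -[|d] f rf; first by rewrite /mxtrace big_ord0.
have [//|rho [rtr _]] := fdrep_of_mrep _ rf; rewrite -rtr.
apply/eqP/negPn/negP=> rc; apply: nrho; exists rho.
by rewrite -(coclsK u) cotrE.
Qed.

Lemma RFD_mrep (C : algType K) :
  RFD C -> exists d (f : C -> 'M[K]_d), (0 < d)%N /\ mrep id f.
Proof.
move=> rfd; have [rho _] := rfd 1 (oner_neq0 C).
by have [d [f [d0 rf _ _]]] := mrep_of_fdrep rho; exists d, f.
Qed.

Lemma comm_spaceM (C : algType K) (x y : C) : x * y - y * x \in comm_space C.
Proof.
by apply/comm_spaceP; exists [:: (1, (x, y))]; rewrite big_seq1 scale1r.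
Qed.

Lemma comm_spaceZ (C : algType K) k (x : C) :
  x \in comm_space C -> k *: x \in comm_space C.
Proof. by move=> xC; rewrite -[X in X \in _]addr0 comm_spaceZD ?comm_space0. Qed.

Lemma trace_null_comm (C : algType K) (c : C) : c \in comm_space C -> trace_null c.
Proof.
move=> /comm_spaceP[s ->] d f rf; rewrite (mrep_sum _ rf) // linear_sum big1 // => t _.
have [_ _ fM] := rf.
rewrite (mrepZ _ rf) //= mxtraceZ /commutator (mrepB _ rf) // !fM linearB /=.
by rewrite mxtrace_mulC subrr mulr0.
Qed.

End FdrepOfMrep.

(** * From the free product to a factor *)

Section Factor.
Variables (K : fieldType) (charK0 : [pchar K] =i pred0).
Variables (A B P : algType K).
Variables (iA : {lrmorphism A -> P}) (iB : {lrmorphism B -> P}).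
Hypothesis freeP : is_free_product iA iB.

(** This is the Hattori-Stallings trace. *)
Definition cotrmx d (M : 'M[A]_d) : cocenter A := \sum_i cocls (M i i).

Lemma cotrmxD d (M N : 'M[A]_d) : cotrmx (M + N) = cotrmx M + cotrmx N.
Proof. by rewrite -big_split; apply: eq_bigr => i _; rewrite mxE raddfD. Qed.

Lemma cotrmxZ d k (M : 'M[A]_d) : cotrmx (k%:A *: M) = k *: cotrmx M.
Proof.
rewrite scaler_sumr; apply: eq_bigr => i _.
by rewrite mxE -scalerAl mul1r linearZ.
Qed.

Lemma cotrmxC d (M N : 'M[A]_d) : cotrmx (M *m N) = cotrmx (N *m M).
Proof.
rewrite /cotrmx; under eq_bigr do rewrite mxE raddf_sum.
rewrite exchange_big; apply: eq_bigr => i _ /=; rewrite mxE raddf_sum.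
by apply: eq_bigr => j _; apply/coclsP; apply: comm_spaceM.
Qed.

Lemma alg1 : (1 : K)%:A = 1 :> A. Proof. exact: scale1r. Qed.

Lemma free_factor_trace_RFD : trace_RFD P -> trace_RFD A.
Proof.
move=> /(trace_RFDP charK0)[rfdP trP]; apply/(trace_RFDP charK0).
have [d [f [d0 rf]]] := RFD_mrep rfdP.
have [fL f1 fM] := mrep_comp rf iB.
(* [B] acts through a representation of [P] with its entries viewed as scalars of [A], and [A]
   through scalar matrices. *)
pose be b : 'M[A]_d := map_mx (in_alg A) (f (iB b)).
pose al (a : A) : 'M[A]_d := a%:M.
have ral : mrep (fun c => c%:A) al.
  split=> [k x y||x y] //; last by rewrite /al scalar_mxM.
  by rewrite /al raddfD /= scale_scalar_mx -scalerAl mul1r.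
have rbe : mrep (fun c => c%:A) be.
  split=> [k x y||x y]; rewrite /be.
  - by have /= -> := fL k x y; rewrite map_mxD map_mxZ.
  - by have /= -> := f1; rewrite map_mx1.
  by have /= -> := fM x y; rewrite map_mxM.
have [h rh [hA _]] := free_product_mrep freeP ral rbe.
have iA_inj a : iA a = 0 -> a = 0.
  move=> a0; have := hA a; rewrite a0 (mrep0 alg1 rh).
  move=> /matrixP/(_ (Ordinal d0) (Ordinal d0)).
  by rewrite !mxE eqxx.
split.
  apply/(RFDP charK0) => a a0; apply: iA_inj; apply: (iffLR (RFDP charK0 _) rfdP).
  move=> e g rg; exact: (a0 _ _ (mrep_comp rg iA)).
move=> a a0.
have : iA a \in comm_space P by apply: trP => e g rg; exact: (a0 _ _ (mrep_comp rg iA)).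
move=> /comm_spaceP[s iAa].
(* [cotrmx \o h] is tracial, so it kills each commutator in the expansion of [iA a]. *)
have : cotrmx (h (iA a)) = 0.
  rewrite iAa; elim: s {iAa} => [|t s IHs].
    by rewrite big_nil (mrep0 alg1 rh) /cotrmx big1 // => i _; rewrite mxE raddf0.
  have [hL _ hM] := rh; rewrite big_cons hL cotrmxD IHs addr0 cotrmxZ.
  have eqC : cotrmx (h (t.2.1 * t.2.2)) = cotrmx (h (t.2.2 * t.2.1)).
    by rewrite !hM cotrmxC.
  rewrite /commutator; move: eqC; rewrite -{1}(subrK (t.2.2 * t.2.1) (_ * _)).
  by rewrite (mrepD alg1 rh) cotrmxD => /(canRL (addrK _)) ->; rewrite subrr scaler0.
rewrite hA /cotrmx; under eq_bigr do rewrite mxE eqxx mulr1n.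
rewrite sumr_const card_ord => /eqP; rewrite -scaler_nat scaler_eq0.
by rewrite (iffLR (pcharf0P _) charK0) -leqn0 leqNgt d0 /= cocls_eq0.
Qed.

End Factor.

(** * Direct sums and tensor products of representations *)

Section Constructions.
Variables (K : fieldType) (C : algType K).

Lemma mrep_block d1 d2 (f : C -> 'M[K]_d1) (g : C -> 'M[K]_d2) :
  mrep id f -> mrep id g -> mrep id (fun c => block_mx (f c) 0 0 (g c)).
Proof.
move=> [fL f1 fM] [gL g1 gM]; split=> [k x y||x y].
- by rewrite fL gL scale_block_mx add_block_mx !scaler0 !addr0.
- by rewrite f1 g1 -scalar_mx_block.
by rewrite mulmx_block fM gM !mulmx0 !mul0mx !addr0 add0r.
Qed.

Lemma tensmx11 m n : (1%:M : 'M[K]_m) *t (1%:M : 'M[K]_n) = 1%:M.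
Proof.
apply/matrixP=> i j; rewrite !mxE -natrM mulnb -xpair_eqE.
by rewrite (inj_eq (can_inj (@mxtens_unindexK m n))).
Qed.

Lemma mrep_tensl d m (f : C -> 'M[K]_d) :
  mrep id f -> mrep id (fun c => f c *t (1%:M : 'M[K]_m)).
Proof.
move=> [fL f1 fM]; split=> [k x y||x y]; last by rewrite fM tensmx_mul mulmx1.
  by apply/matrixP=> i j; rewrite !mxE fL !mxE mulrDl mulrA.
by rewrite f1 tensmx11.
Qed.

Lemma mrep_tensr d m (f : C -> 'M[K]_d) :
  mrep id f -> mrep id (fun c => (1%:M : 'M[K]_m) *t f c).
Proof.
move=> [fL f1 fM]; split=> [k x y||x y]; last by rewrite fM tensmx_mul mulmx1.
  by apply/matrixP=> i j; rewrite !mxE fL !mxE mulrDr mulrCA.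
by rewrite f1 tensmx11.
Qed.

End Constructions.

Lemma mxtrace_tens (K : fieldType) m n (M : 'M[K]_m) (N : 'M[K]_n) :
  \tr (M *t N) = \tr M * \tr N.
Proof.
rewrite /mxtrace mulr_sum; apply: eq_bigr => i _.
by case: (mxtens_indexP i) => i1 i2; rewrite tensmxE mxtens_indexK.
Qed.

(** * Coefficient functionals vanishing at 1 *)

Section CoefFun.
Variables (K : fieldType) (C : algType K).

Definition coef_fun (lam : C -> K) : Prop :=
  exists d (f : C -> 'M[K]_d) (phi : 'rV[K]_d) (u : 'cV[K]_d),
    [/\ mrep id f, phi *m u = 0 & forall x, lam x = (phi *m f x *m u) 0 0].

Lemma coef_funP lam k x y : coef_fun lam -> lam (k *: x + y) = k * lam x + lam y.
Proof.
move=> [d [f [phi [u [[fL _ _] _ lamE]]]]].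
by rewrite !lamE fL mulmxDr mulmxDl -scalemxAr -scalemxAl !mxE.
Qed.

Lemma coef_fun1 lam : coef_fun lam -> lam 1 = 0.
Proof.
by move=> [d [f [phi [u [[_ f1 _] phiu lamE]]]]]; rewrite lamE f1 mulmx1 phiu mxE.
Qed.

Lemma coef_fun_at0 lam : coef_fun lam -> lam 0 = 0.
Proof. by move=> [d [f [phi [u [rf _ ->]]]]]; rewrite (mrep0 _ rf) // mulmx0 mul0mx mxE. Qed.

Lemma coef_fun_scale lam k x : coef_fun lam -> lam (k *: x) = k * lam x.
Proof. by move=> cl; rewrite -[k *: x]addr0 coef_funP // coef_fun_at0 // addr0. Qed.

Lemma coef_fun_add lam x y : coef_fun lam -> lam (x + y) = lam x + lam y.
Proof. by move=> cl; rewrite -[x]scale1r coef_funP // mul1r scale1r. Qed.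

Lemma coef_fun_big lam (I : Type) (r : seq I) (F : I -> C) :
  coef_fun lam -> lam (\sum_(i <- r) F i) = \sum_(i <- r) lam (F i).
Proof.
by move=> cl; apply: (big_morph lam) => [x y|]; rewrite ?coef_fun_add ?coef_fun_at0.
Qed.

Lemma coef_fun0 : coef_fun (fun=> 0).
Proof.
exists 0%N, (fun=> 0), 0, 0; split; rewrite ?mul0mx //; last by move=> x; rewrite mxE.
by split=> *; apply/matrixP=> -[].
Qed.

Lemma coef_fun_comb lam mu k :
  coef_fun lam -> coef_fun mu -> coef_fun (fun x => lam x + k * mu x).
Proof.
move=> [d [f [phi [u [rf phiu lamE]]]]] [e [g [psi [v [rg psiv muE]]]]].
exists (d + e)%N, (fun c => block_mx (f c) 0 0 (g c)), (row_mx phi (k *: psi)), (col_mx u v).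
split=> [||x]; first exact: mrep_block.
  by rewrite mul_row_col -scalemxAl phiu psiv scaler0 addr0.
rewrite mul_row_block !mulmx0 addr0 add0r mul_row_col -!scalemxAl.
by rewrite [RHS]mxE -lamE [in RHS]mxE -muE.
Qed.

Lemma coef_fun_sum (I : Type) (r : seq I) (k : I -> K) (lam : I -> C -> K) :
  (forall i, coef_fun (lam i)) -> coef_fun (fun x => \sum_(i <- r) k i * lam i x).
Proof.
move=> cl; elim: r => [|i r IHr].
  by under eq_fun do rewrite big_nil; apply: coef_fun0.
by under eq_fun do rewrite big_cons addrC; apply: coef_fun_comb.
Qed.

(** The pair [e_i], [e_j] kills an off-diagonal entry; the pair [e_i - e_j], [e_i + e_j] then
    compares two diagonal ones. *)
Lemma scalar_mx_of_coef d (M : 'M[K]_d) :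
    (forall (phi : 'rV_d) (u : 'cV_d), phi *m u = 0 -> (phi *m M *m u) 0 0 = 0) ->
  exists k, M = k%:M.
Proof.
move=> M0; have Mij i j : i != j -> M i j = 0.
  move=> ij; have := M0 (delta_mx 0 i) (delta_mx j 0).
  by rewrite mul_delta_mx_0 // -rowE -colE !mxE; apply.
have Mii i j : M i i = M j j.
  have [->//|ij] := eqVneq i j.
  have uv0 : (delta_mx 0 i - delta_mx 0 j) *m (delta_mx i 0 + delta_mx j 0) = 0 :> 'M[K]_1.
    rewrite mulmxBl !mulmxDr !mul_delta_mx !mul_delta_mx_0 ?(eq_sym j) //.
    by rewrite addr0 add0r subrr.
  have := M0 _ _ uv0; rewrite !(mulmxBl, mulmxDr) -!rowE -!colE !mxE.
  rewrite (Mij i j) // (Mij j i) 1?eq_sym // subr0 sub0r.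
  by move/eqP; rewrite subr_eq0 => /eqP.
case: d M {M0} Mij Mii => [|d] M Mij Mii; first by exists 0; apply/matrixP=> -[].
exists (M 0 0); apply/matrixP=> i j; rewrite mxE.
by case: eqVneq => [->|/Mij->//]; rewrite mulr1n.
Qed.

Hypothesis charK0 : [pchar K] =i pred0.
Hypothesis rfdC : RFD C.

(** By [scalar_mx_of_coef], [a] acts by a scalar in every representation. Direct sums with one fixed
    nonzero representation force these scalars to agree, and [RFD C] identifies [a] with the common
    value. *)
Lemma coef_fun_sep a : (forall lam, coef_fun lam -> lam a = 0) -> exists k, a = k%:A.
Proof.
move=> a0; have ra d (f : C -> 'M[K]_d) : mrep id f -> exists k, f a = k%:M.
  move=> rf; apply: scalar_mx_of_coef => phi u phiu.
  by apply: (a0 (fun x => (phi *m f x *m u) 0 0)); exists d, f, phi, u.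
have [d [f [d0 rf]]] := RFD_mrep rfdC; have [k fa] := ra _ _ rf.
exists k; apply/eqP; rewrite -subr_eq0; apply/eqP.
apply: (iffLR (RFDP charK0 _) rfdC) => e g rg.
have [l] := ra _ _ (mrep_block rf rg).
rewrite fa scalar_mx_block => /eq_block_mx[/matrixP/(_ (Ordinal d0) (Ordinal d0)) + _ _ gl].
rewrite !mxE eqxx !mulr1n => kl.
have [_ g1 _] := rg.
by rewrite (mrepB _ rg) // (mrepZ _ rg) // gl -kl g1 scalemx1 subrr.
Qed.

(** A Gram-Schmidt process modulo scalars. [D] is the remainder of the expansion so far; when [D a]
    is not scalar, it joins the list with the functional [mu \o D], where [mu (D a) = 1]. *)
Lemma coef_fun_decomp (l : seq C) :
  exists s : seq ({lam : C -> K | coef_fun lam} * C),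
    forall a, a \in l -> exists k, a = \sum_(t <- s) sval t.1 a *: t.2 + k%:A.
Proof.
elim: l => [|a l [s IHs]]; first by exists [::].
pose D z := z - \sum_(t <- s) sval t.1 z *: t.2.
have [[k Da]|nDa] := pselect (exists k, D a = k%:A).
  exists s => z; rewrite inE => /predU1P[->|/IHs//].
  by exists k; rewrite -Da addrC subrK.
have [mu [cmu muDa]] : exists mu, coef_fun mu /\ mu (D a) = 1.
  apply: contrapT => nmu; apply: nDa; apply: coef_fun_sep => lam cl.
  apply/eqP/negPn/negP=> la0; apply: nmu; exists (fun x => 0 + (lam (D a))^-1 * lam x).
  by split; [apply: coef_fun_comb coef_fun0 cl | rewrite add0r mulVf].
have cmu' : coef_fun (fun z => mu z + -1 * \sum_(t <- s) mu t.2 * sval t.1 z).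
  by apply: coef_fun_comb => //; apply: coef_fun_sum => t; apply: svalP.
have mu'E z : mu z + -1 * (\sum_(t <- s) mu t.2 * sval t.1 z) = mu (D z).
  rewrite /D [in RHS]addrC -scaleN1r (coef_funP _ _ _ cmu) (coef_fun_big _ _ cmu) addrC.
  by congr (_ * _ + _); apply: eq_bigr => t _; rewrite (coef_fun_scale _ _ cmu) mulrC.
exists ((exist _ _ cmu', D a) :: s) => z; rewrite inE big_cons /= mu'E.
case/predU1P=> [->|/IHs[k zE]].
  by exists 0; rewrite muDa !scale1r scale0r addr0 /D subrK.
(* For [z] in the older list [D z] is scalar, so [mu] kills it and the new term leaves its expansion
   intact. *)
exists k; have -> : D z = k%:A by rewrite /D {1}zE addrC addKr.
by rewrite (coef_fun_scale _ _ cmu) (coef_fun1 cmu) mulr0 scale0r add0r.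
Qed.

End CoefFun.

(** * Families realized by a square-zero endomorphism *)

Section Realizable.
Variables (K : fieldType) (A B : algType K).

Definition realizable r (ell : bool -> A * B -> 'M[K]_r) : Prop :=
  exists d (al : A -> 'M[K]_d) (be : B -> 'M[K]_d) (Q : 'M[K]_(r, d)) (U : 'M[K]_(d, r)),
    [/\ mrep id al, mrep id be, Q *m U = 0 &
        forall s z, ell s z = Q *m (if s then al z.1 else be z.2) *m U].

Lemma realizable0 r : realizable (fun _ _ => 0 : 'M[K]_r).
Proof.
exists 0%N, (fun=> 0), (fun=> 0), 0, 0; split; rewrite ?mul0mx //.
- by split=> *; apply/matrixP=> -[].
- by split=> *; apply/matrixP=> -[].
by move=> *; rewrite !mul0mx.
Qed.

Lemma realizableD r (ell1 ell2 : bool -> A * B -> 'M[K]_r) :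
  realizable ell1 -> realizable ell2 -> realizable (fun s z => ell1 s z + ell2 s z).
Proof.
move=> [d [al [be [Q [U [ra rb QU ellE]]]]]] [e [al' [be' [Q' [U' [ra' rb' QU' ellE']]]]]].
exists (d + e)%N, (fun c => block_mx (al c) 0 0 (al' c)).
exists (fun c => block_mx (be c) 0 0 (be' c)).
exists (row_mx Q Q'), (col_mx U U').
split=> [|||s z]; try exact: mrep_block; first by rewrite mul_row_col QU QU' addr0.
rewrite ellE ellE'.
by case: s; rewrite mul_row_block !mulmx0 addr0 add0r mul_row_col.
Qed.

Lemma realizable_sum r (I : Type) (l : seq I) (ell : I -> bool -> A * B -> 'M[K]_r) :
  (forall i, realizable (ell i)) -> realizable (fun s z => \sum_(i <- l) ell i s z).
Proof.
move=> rl; elim: l => [|i l IHl].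
  have -> : (fun s z => \sum_(i <- [::]) ell i s z) = (fun _ _ => 0 : 'M[K]_r).
    by apply/funext=> s; apply/funext=> z; rewrite big_nil.
  exact: realizable0.
have -> : (fun s z => \sum_(j <- i :: l) ell j s z)
    = (fun s z => ell i s z + \sum_(j <- l) ell j s z).
  by apply/funext=> s; apply/funext=> z; rewrite big_cons.
exact: realizableD.
Qed.

End Realizable.

Lemma tens_mx11E (K : fieldType) (X Y : 'M[K]_1) : (X *t Y : 'M_1) 0 0 = X 0 0 * Y 0 0.
Proof. by rewrite mxE !ord1. Qed.

Lemma delta_mx11_delta (K : fieldType) r (i j : 'I_r) (M : 'M[K]_1) :
  delta_mx i 0 *m M *m delta_mx 0 j = M 0 0 *: delta_mx i j.
Proof.
by rewrite {1}[M]mx11_scalar mul_mx_scalar -scalemxAl mul_delta_mx.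
Qed.

(* [C] acts on [V (x) W] through the first factor and [D] through the second, so
   a covector and a vector that are orthogonal in [V] kill the action of [D]. *)
Lemma coef_fun_realize (K : fieldType) (C D : algType K) (lam : C -> K) m (g : D -> 'M[K]_m)
    r (i j : 'I_r) :
    coef_fun lam -> (0 < m)%N -> mrep id g ->
  exists d (al : C -> 'M[K]_d) (be : D -> 'M[K]_d) (Q : 'M[K]_(r, d)) (U : 'M[K]_(d, r)),
    [/\ mrep id al, mrep id be, Q *m U = 0,
        forall x, Q *m al x *m U = lam x *: delta_mx i j &
        forall y, Q *m be y *m U = 0].
Proof.
move=> [d [f [phi [u [rf phiu lamE]]]]] m0 rg.
pose om : 'rV[K]_m := delta_mx 0 (Ordinal m0); pose w : 'cV[K]_m := delta_mx (Ordinal m0) 0.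
have omw : om *m w = 1%:M by rewrite mul_delta_mx; apply/matrixP=> k l; rewrite !ord1 !mxE.
pose q : 'M[K]_(1, d * m) := phi *t om; pose v : 'M[K]_(d * m, 1) := u *t w.
have qv : q *m v = 0 by rewrite /q /v (tensmx_mul phi om u w) phiu tens0mx.
have qXv X Y : delta_mx i 0 *m q *m (X *t Y) *m (v *m delta_mx 0 j)
    = delta_mx i 0 *m ((phi *m X *m u) *t (om *m Y *m w) : 'M_1) *m delta_mx 0 j.
  by rewrite -(tensmx_mul (phi *m X)) -(tensmx_mul phi) !mulmxA.
exists (d * m)%N, (fun x => f x *t 1%:M), (fun y => 1%:M *t g y).
exists (delta_mx i 0 *m q), (v *m delta_mx 0 j).
split; [exact: mrep_tensl | exact: mrep_tensr | | move=> x | move=> y].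
- by rewrite mulmxA -(mulmxA _ q) qv mulmx0 mul0mx.
- by rewrite qXv mulmx1 omw delta_mx11_delta tens_mx11E -lamE mxE mulr1.
by rewrite qXv mulmx1 phiu tens0mx mulmx0 mul0mx.
Qed.

(** * Products along words *)

Section SideFun.
Variables (K : fieldType) (A B : algType K).

(* A letter is a pair in [A * B]; the side [true] (resp. [false]) says that its
   [A]-component (resp. [B]-component) is the relevant one. *)
Definition side_fun (s : bool) (phi : A * B -> K) : Prop :=
  if s then exists2 lam, coef_fun lam & phi =1 lam \o fst
  else exists2 lam, coef_fun lam & phi =1 lam \o snd.

Hypotheses (rfdA : RFD A) (rfdB : RFD B).

(** [coef_fun_realize] asks for a nonzero representation of the other algebra as second tensor
    factor; that algebra being RFD supplies one. *)
Lemma realizable_unit s phi r (i j : 'I_r) : side_fun s phi ->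
  realizable (fun s' z => ((s' == s)%:R * phi z) *: delta_mx i j).
Proof.
have [m [f [m0 rf]]] := RFD_mrep rfdA; have [n [g [n0 rg]]] := RFD_mrep rfdB.
case: s => -[lam cl phiE].
  have [d [al [be [Q [U [ra rb QU alE beE]]]]]] := coef_fun_realize i j cl n0 rg.
  exists d, al, be, Q, U; split=> // -[] z; first by rewrite alE phiE mul1r.
  by rewrite beE mul0r scale0r.
have [d [be [al [Q [U [rb ra QU beE alE]]]]]] := coef_fun_realize i j cl m0 rf.
exists d, al, be, Q, U; split=> // -[] z; last by rewrite beE phiE mul1r.
by rewrite alE mul0r scale0r.
Qed.

Definition alternating s (f : nat -> A * B -> K) : Prop :=
  forall k, side_fun (s (+) odd k) (f k).

(** A weighted cyclic permutation matrix split by sides: the edge leaving [i] is present only for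
    the side that letter [i] has in an alternating word begun on [s0]. *)
Definition cycle_mx r (s0 : bool) (f : nat -> A * B -> K) s z : 'M[K]_r :=
  \sum_(i < r) ((s == s0 (+) odd i)%:R * f i z) *: delta_mx i (ordS i).

Arguments cycle_mx {r}.

Lemma realizable_cycle r s0 f : alternating s0 f -> realizable (@cycle_mx r s0 f).
Proof. by move=> altf; apply: realizable_sum => i; apply: realizable_unit. Qed.

Lemma mul_delta_mxE r m n (M : 'M[K]_(n, m)) (i a : 'I_r) k b :
  (delta_mx i k *m M) a b = (a == i)%:R * M k b.
Proof.
rewrite mxE (bigD1 k) //= big1 => [|l lk]; first by rewrite addr0 mxE eqxx andbT.
by rewrite mxE (negPf lk) andbF mul0r.
Qed.

Lemma cycle_mxE r s0 f s z m (M : 'M[K]_(r, m)) i j :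
  (cycle_mx s0 f s z *m M) i j = (s == s0 (+) odd i)%:R * f i z * M (ordS i) j.
Proof.
rewrite /cycle_mx mulmx_suml summxE (bigD1 i) //= big1 => [|k ki].
  by rewrite addr0 -scalemxAl mxE mul_delta_mxE eqxx mul1r.
by rewrite -scalemxAl mxE mul_delta_mxE [i == k]eq_sym (negPf ki) mul0r mulr0.
Qed.

Fixpoint wprod r (ell : bool -> A * B -> 'M[K]_r) (s : bool) (w : seq (A * B)) : 'M[K]_r :=
  if w is z :: w' then ell s z *m wprod ell (~~ s) w' else 1%:M.

Fixpoint wval (f : nat -> A * B -> K) (w : seq (A * B)) : K :=
  if w is z :: w' then f 0%N z * wval (fun k => f k.+1) w' else 1.

Lemma eq_wval f g w : (forall k, (k < size w)%N -> f k = g k) -> wval f w = wval g w.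
Proof.
elim: w f g => //= z w IHw f g fg; rewrite (fg 0%N) //; congr (_ * _).
by apply: IHw => k kw; apply: fg.
Qed.

Lemma wval_cat f u v : wval f (u ++ v) = wval f u * wval (fun k => f (size u + k)%N) v.
Proof. by elim: u f => [|z u IHu] f /=; rewrite ?mul1r // IHu mulrA. Qed.

Lemma wprod_cycle r s0 f s w (i j : 'I_r) : ~~ odd r -> s = s0 (+) odd i ->
  wprod (cycle_mx s0 f) s w i j =
    (j == ((i + size w) %% r)%N :> nat)%:R * wval (fun k => f ((i + k) %% r)%N) w.
Proof.
move=> evr; elim: w s i => [|z w IHw] s i si /=.
  by rewrite mxE addn0 modn_small // mulr1 eq_sym.
rewrite cycle_mxE si eqxx mul1r IHw; last first.
  by rewrite /= odd_mod ?(negPf evr) //= addbN.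
rewrite mulrCA; congr (_ * _).
  by rewrite /= modnDml addSnnS.
rewrite addn0 modn_small //; congr (_ * _); apply: eq_wval => k _.
by rewrite /= modnDml addSnnS.
Qed.

Lemma wprod_cycle0 r s0 f s z w (i j : 'I_r) : s != s0 (+) odd i ->
  wprod (cycle_mx s0 f) s (z :: w) i j = 0.
Proof. by move=> si; rewrite /= cycle_mxE (negPf si) !mul0r. Qed.

Lemma realizable_path s f n : alternating s f ->
  exists r (ell : bool -> A * B -> 'M[K]_r) (i j : 'I_r),
    [/\ realizable ell,
        forall w, size w = n -> wprod ell s w i j = wval f w &
        forall z w, wprod ell (~~ s) (z :: w) i j = 0].
Proof.
move=> altf; pose r := n.+1.*2; have nr : (n < r)%N by rewrite /r -addnn ltn_addr.
have r0 : (0 < r)%N by [].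
exists r, (cycle_mx s f), (Ordinal r0), (Ordinal nr).
split=> [|w wn|z w]; first exact: realizable_cycle.
  rewrite wprod_cycle ?odd_double //=; last by rewrite addbF.
  rewrite wn add0n modn_small // eqxx mul1r; apply: eq_wval => k.
  by rewrite wn add0n => kn; rewrite modn_small // (ltn_trans kn).
by rewrite wprod_cycle0 //= addbF; case: (s).
Qed.

Lemma wval_rotr f i w : (i < size w)%N ->
  wval (fun k => f ((i + k) %% size w)%N) w = wval f (rotr i w).
Proof.
move=> iw; have iw' := ltnW iw.
rewrite /rotr /rot -{2}(cat_take_drop (size w - i) w) !wval_cat mulrC.
have szt : size (take (size w - i) w) = (size w - i)%N by rewrite size_takel ?leq_subr.
have szd : size (drop (size w - i) w) = i by rewrite size_drop subKn.
congr (_ * _); apply: eq_wval => k.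
  rewrite szd szt => ki; rewrite addnA subnKC // modnDl modn_small //.
  exact: ltn_trans iw.
by rewrite szt szd => ki; rewrite modn_small -?ltn_subRL.
Qed.

(** A word as long as the cycle returns to its starting vertex. From an even vertex [i] it meets the
    functionals shifted by [i], as its rotation would meet the unshifted ones; odd vertices are on
    the wrong side. *)
Lemma realizable_cycle_trace s f n : alternating s f ->
  exists r (ell : bool -> A * B -> 'M[K]_r), realizable ell /\
    forall w, size w = n.*2 ->
      \tr (wprod ell s w) = \sum_(i < n.*2) (~~ odd i)%:R * wval f (rotr i w).
Proof.
move=> altf; exists n.*2, (cycle_mx s f); split; first exact: realizable_cycle.
case=> [|z w] wn.
  by rewrite -wn /mxtrace !big_ord0.
move En: (z :: w) wn => w0 wn; apply: eq_bigr => i _.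
case: (boolP (odd i)) => [io|ie] /=; last first.
  rewrite wprod_cycle ?odd_double //; last by rewrite (negPf ie) addbF.
  by rewrite wn modnDr modn_small // eqxx -wval_rotr wn.
by rewrite -En wprod_cycle0 ?mul0r // io addbT; case: (s).
Qed.

End SideFun.

(** * Deformation by a square-zero endomorphism *)

Section MxTop.
Variable K : fieldType.
Local Notation pc := (map_mx (@polyC K)).

(** [C] may be zero: [n] only bounds the degree, which makes the relation linear for fixed [n]. *)
Definition mxtop m p n (M : 'M[{poly K}]_(m, p)) (C : 'M[K]_(m, p)) : Prop :=
  forall i j, (size (M i j) <= n.+1)%N /\ (M i j)`_n = C i j.

Lemma coef_top_mul n m (p q : {poly K}) : (size p <= n.+1)%N -> (size q <= m.+1)%N ->
  (size (p * q)%R <= (n + m).+1)%N /\ (p * q)`_(n + m) = p`_n * q`_m.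
Proof.
move=> pn qm; split.
  apply: leq_trans (size_polyMleq p q) _; rewrite -addnS -subn1 leq_subLR add1n -addSn.
  exact: leq_add.
have nle : (n < (n + m).+1)%N by rewrite ltnS leq_addr.
rewrite coefM (bigD1 (Ordinal nle)) //= addKn big1 ?addr0 // => i.
rewrite -val_eqE /= neq_ltn => /orP[lt_in|lt_ni].
  rewrite [q`__]nth_default ?mulr0 //; apply: leq_trans qm _.
  by rewrite ltn_subRL ltn_add2r.
by rewrite [p`__]nth_default ?mul0r // (leq_trans pn).
Qed.

Lemma mxtop_const m p (C : 'M[K]_(m, p)) : mxtop 0 (pc C) C.
Proof. by move=> i j; rewrite mxE size_polyC coefC leq_b1. Qed.

Lemma mxtop_lin m p n k (M N : 'M[{poly K}]_(m, p)) C D :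
  mxtop n M C -> mxtop n N D -> mxtop n (k%:P *: M + N) (k *: C + D).
Proof.
move=> MC ND i j; have [sM cM] := MC i j; have [sN cN] := ND i j.
rewrite !mxE coefD coefCM cM cN; split=> //.
apply: leq_trans (size_polyD _ _) _; rewrite geq_max sN andbT.
by rewrite mul_polyC (leq_trans (size_scale_leq _ _)).
Qed.

Lemma mxtop0 m p n : mxtop n (0 : 'M[{poly K}]_(m, p)) 0.
Proof. by move=> i j; rewrite !mxE size_poly0 coef0. Qed.

Lemma mxtop_sum m p n (I : eqType) (r : seq I) (k : I -> K)
    (M : I -> 'M[{poly K}]_(m, p)) C :
  (forall i, i \in r -> mxtop n (M i) (C i)) ->
  mxtop n (\sum_(i <- r) (k i)%:P *: M i) (\sum_(i <- r) k i *: C i).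
Proof.
elim: r => [|i r IHr] MC; first by rewrite !big_nil; apply: mxtop0.
rewrite !big_cons; apply: mxtop_lin; first by apply: MC; rewrite mem_head.
by apply: IHr => j jr; apply: MC; rewrite inE jr orbT.
Qed.

Lemma mxtop_inj m p n (C : 'M[K]_(m, p)) : mxtop n 0 C -> C = 0.
Proof. by move=> C0; apply/matrixP=> i j; have [_ <-] := C0 i j; rewrite !mxE coef0. Qed.

Lemma mxtop_mul m p q n1 n2 (M : 'M[{poly K}]_(m, p)) (N : 'M[{poly K}]_(p, q)) C D :
  mxtop n1 M C -> mxtop n2 N D -> mxtop (n1 + n2) (M *m N) (C *m D).
Proof.
move=> MC ND i j; rewrite !mxE; split.
  apply: leq_trans (size_sum _ _ _) _; apply/bigmax_leqP=> k _.
  exact: (coef_top_mul (MC i k).1 (ND k j).1).1.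
rewrite coef_sum; apply: eq_bigr => k _.
by rewrite (coef_top_mul (MC i k).1 (ND k j).1).2 (MC i k).2 (ND k j).2.
Qed.

Lemma mxtop_tr d n (M : 'M[{poly K}]_d) C : mxtop n M C -> (\tr M)`_n = \tr C.
Proof. by move=> MC; rewrite coef_sum; apply: eq_bigr => i _; have [] := MC i i. Qed.

End MxTop.

(** In characteristic 0 the integers below [size q] are distinct, which makes more roots than the
    degree allows. *)
Lemma poly_fun0 (K : fieldType) (charK0 : [pchar K] =i pred0) (q : {poly K}) :
  (forall t, q.[t] = 0) -> q = 0.
Proof.
move=> q0; apply/eqP/negPn/negP=> nq.
pose rs := [seq i%:R : K | i <- iota 0 (size q)].
have urs : uniq rs.
  rewrite map_inj_uniq ?iota_uniq // => i j /eqP.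
  wlog ij : i j / (i <= j)%N => [W|].
    by case/orP: (leq_total i j) => [/W//|/W W' /eqP/esym/eqP/W'].
  rewrite eq_sym -subr_eq0 -natrB // (iffLR (pcharf0P _) charK0) subn_eq0 => ji.
  by apply/eqP; rewrite eqn_leq ij.
have ars : all (root q) rs by apply/allP=> x _; apply/rootP.
by have := max_poly_roots nq ars urs; rewrite size_map size_iota ltnn.
Qed.

Lemma mrep_horner (K : fieldType) (C : algType K) d (h : C -> 'M[{poly K}]_d) t :
  mrep (fun c => c%:A) h -> mrep id (fun c => map_mx (horner_eval t) (h c)).
Proof.
move=> [hL h1 hM]; split=> [k x y||x y].
- by rewrite hL map_mxD map_mxZ /= /horner_eval alg_polyC hornerC.
- by rewrite h1 map_mx1.
by rewrite hM map_mxM.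
Qed.

Section Deformation.
Variables (K : fieldType) (A B P : algType K).
Variables (iA : {lrmorphism A -> P}) (iB : {lrmorphism B -> P}).
Hypothesis freeP : is_free_product iA iB.

Definition letter (s : bool) (z : A * B) : P := if s then iA z.1 else iB z.2.

Fixpoint word (s : bool) (w : seq (A * B)) : P :=
  if w is z :: w' then letter s z * word (~~ s) w' else 1.

Definition tsign (s : bool) : K := if s then 1 else -1.
Fixpoint wsign (s : bool) (n : nat) : K :=
  if n is n'.+1 then tsign s * wsign (~~ s) n' else 1.

Lemma wsign_neq0 s n : wsign s n != 0.
Proof.
elim: n s => [|n IHn] s /=; first exact: oner_neq0.
by rewrite mulf_neq0 //; case: s; rewrite ?oppr_eq0 oner_neq0.
Qed.

Local Notation pc := (map_mx (@polyC K)).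

(* [A] acts through [al] and [B] through the conjugate of [be] by the unipotent
   [1 + 'X E], where [E = U Q] has square zero. In a product of [n] alternating
   letters the conjugators recombine into [n - 1] factors [1 +- 'X E] between
   consecutive letters, so the top coefficient only involves [Q z U = ell z]. *)
Lemma deformed_rep r (ell : bool -> A * B -> 'M[K]_r) : realizable ell ->
  exists d (h : P -> 'M[{poly K}]_d) (Q : 'M[{poly K}]_(r, d)) (U : 'M[{poly K}]_(d, r)),
    [/\ mrep (fun c => c%:A) h,
        Q *m U = 0,
        forall s z w,
          mxtop (size w) (Q *m h (word s (z :: w)) *m U)
            (wsign s (size w) *: wprod ell s (z :: w)) &
        forall s z w, odd (size w) ->
          (\tr (h (word s (z :: w))))`_(size w).+1
            = wsign s (size w).+1 * \tr (wprod ell s (z :: w))].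
Proof.
move=> [d [al [be [Q [U [ra rb QU ellE]]]]]].
pose E := U *m Q; pose XE := 'X *: pc E.
have QE : Q *m E = 0 by rewrite mulmxA QU mul0mx.
have EU : E *m U = 0 by rewrite -mulmxA QU mulmx0.
have EE : E *m E = 0 by rewrite {1}/E -mulmxA QE mulmx0.
have XEXE : XE *m XE = 0.
  by rewrite -scalemxAl -scalemxAr -map_mxM EE map_mx0 !scaler0.
have QXE : pc Q *m XE = 0 by rewrite -scalemxAr -map_mxM QE map_mx0 scaler0.
have XEU : XE *m pc U = 0 by rewrite -scalemxAl -map_mxM EU map_mx0 scaler0.
pose g s := if s then 1%:M else 1%:M + XE.
pose gi s := if s then 1%:M else 1%:M - XE.
pose Z s (z : A * B) := if s then al z.1 else be z.2.
have gK s : gi s *m g s = 1%:M.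
  case: s; rewrite /g /gi ?mulmx1 // mulmxDl mul1mx mulNmx mulmxDr mulmx1 XEXE.
  by rewrite addr0 addrK.
have gKi s : g s *m gi s = 1%:M by apply: mulmx1C; apply: gK.
(* Passing from [A] to [B] leaves [1 + XE], passing from [B] to [A] leaves [1 - XE]: this is the
   source of [tsign]. *)
have gigN s : gi s *m g (~~ s) = 1%:M + (tsign s)%:P *: XE.
  by case: s; rewrite /g /gi /= ?mul1mx ?mulmx1 ?scale1r // polyCN scaleN1r.
have ral : mrep (fun c : K => c%:A : {poly K}) (fun a => g true *m pc (al a) *m gi true).
  have [aL a1 aM] := ra; split=> [k x y||x y]; rewrite !mul1mx !mulmx1.
  - by rewrite aL map_mxD map_mxZ alg_polyC.
  - by rewrite a1 map_mx1.
  by rewrite aM map_mxM.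
have rbe : mrep (fun c : K => c%:A : {poly K}) (fun b => g false *m pc (be b) *m gi false).
  have [bL b1 bM] := rb; split=> [k x y||x y].
  - rewrite bL map_mxD map_mxZ alg_polyC (mulmxDr (g false)) (mulmxDl _ _ (gi false)).
    by rewrite -scalemxAr -scalemxAl.
  - by rewrite b1 map_mx1 mulmx1 gKi.
  by rewrite bM map_mxM -!mulmxA (mulmxA (gi false)) gK mul1mx.
have [h rh [hA hB]] := free_product_mrep freeP ral rbe.
have [hL h1 hM] := rh.
have hletter s z : h (letter s z) = g s *m pc (Z s z) *m gi s.
  by case: s; rewrite /letter ?hA ?hB.
(* [V] is the word without its outer conjugators; the factor it carries after the last letter is
   compensated by the final [gi] in [hword]. *)
pose V := fix V s w := if w is z :: w' then
  pc (Z s z) *m (1%:M + (tsign s)%:P *: XE) *m V (~~ s) w' else 1%:M.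
have hword s w : h (word s w) = g s *m V s w *m gi (s (+) odd (size w)).
  elim: w s => [|z w IHw] s; first by rewrite /= addbF mulmx1 gKi h1.
  by rewrite /= hM hletter IHw -gigN addNb addbN -!mulmxA.
have topXE s : mxtop 1 (1%:M + (tsign s)%:P *: XE) (tsign s *: E).
  rewrite /XE; move: (E) => F i j; rewrite !mxE.
  have -> : (i == j)%:R + (tsign s)%:P * ('X * (F i j)%:P)
      = (tsign s * F i j)%:P * 'X + ((i == j)%:R)%:P :> {poly K}.
    by rewrite addrC polyC_natr polyCM mulrCA mulrC.
  rewrite size_MXaddC coefD coefMX !coefC addr0; case: ifP => // _.
  by rewrite ltnS size_polyC leq_b1.
pose cw := fix cw s w := if w is z :: w' then
  Z s z *m (tsign s *: E) *m cw (~~ s) w' else 1%:M.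
have topV s w : mxtop (size w) (V s w) (cw s w).
  elim: w s => [|z w IHw] s /=; first by rewrite -(map_mx1 polyC); apply: mxtop_const.
  rewrite -add1n; apply: mxtop_mul (IHw _); rewrite -[1%N]add0n.
  by apply: mxtop_mul (topXE s); apply: mxtop_const.
have Qcw s w : Q *m cw s w = wsign s (size w) *: (wprod ell s w *m Q).
  elim: w s => [|z w IHw] s /=; first by rewrite mulmx1 mul1mx scale1r.
  rewrite -scalemxAr -scalemxAl -scalemxAr /E !mulmxA -(mulmxA _ Q) IHw.
  by rewrite -ellE -scalemxAr scalerA mulmxA.
(* As [E *m U = 0], the factor after the last letter fixes [U]: the last letter adds no degree. *)
have VU s w z : V s (rcons w z) *m pc U = V s w *m pc (Z (s (+) odd (size w)) z *m U).
  elim: w s => [|y w IHw] s /=.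
    rewrite addbF mulmx1 mul1mx map_mxM -mulmxA mulmxDl mul1mx -scalemxAl XEU.
    by rewrite scaler0 addr0.
  by rewrite -mulmxA IHw !mulmxA addNb addbN.
have wprod_rcons s w z :
    wprod ell s (rcons w z) = wprod ell s w *m ell (s (+) odd (size w)) z.
  elim: w s => [|y w IHw] s /=; first by rewrite addbF mulmx1 mul1mx.
  by rewrite IHw mulmxA addNb addbN.
have cwE s z w : cw s (z :: w) = Z s z *m (tsign s *: E) *m cw (~~ s) w by [].
clearbody V cw.
exists d, h, (pc Q), (pc U); split=> // [|s z w|s z w ow].
- by rewrite -map_mxM QU map_mx0.
- have Qg b : pc Q *m g b = pc Q.
    by case: b; rewrite /g ?mulmx1 // mulmxDr mulmx1 QXE addr0.
  have giU b : gi b *m pc U = pc U.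
    by case: b; rewrite /gi ?mul1mx // mulmxBl mul1mx XEU subr0.
  rewrite hword !mulmxA Qg -!mulmxA giU.
  have szw : size (belast z w) = size w by rewrite size_belast.
  rewrite lastI VU wprod_rcons -szw ellE.
  have -> N : wsign s (size (belast z w)) *: (wprod ell s (belast z w) *m (Q *m N *m U))
      = Q *m (cw s (belast z w) *m (N *m U)).
    by rewrite !mulmxA Qcw -!scalemxAl.
  rewrite -[X in mxtop X]add0n; apply: mxtop_mul; first exact: mxtop_const.
  rewrite -[X in mxtop X]addn0; apply: mxtop_mul (mxtop_const _).
  exact: topV.
(* A word of even length has the same conjugator at both ends, and they cancel in the trace. *)
rewrite hword [odd (size _)]/= ow addbF mxtrace_mulC mulmxA gK mul1mx.
rewrite (mxtop_tr (topV s (z :: w))) cwE.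
(* The factor [E = U Q] after the first letter is cut open and the product cycled, so that the first
   letter too appears between [Q] and [U]. *)
rewrite -scalemxAr -scalemxAl linearZ /= /E !mulmxA -(mulmxA _ Q) Qcw.
rewrite -scalemxAr linearZ /= mulmxA mxtrace_mulC mulmxA ellE -mulmxA.
by rewrite mulrA !mulmxA.
Qed.

End Deformation.

(** * Spans of alternating words *)

Section Words.
Variables (K : fieldType) (A B P : algType K).
Variables (iA : {lrmorphism A -> P}) (iB : {lrmorphism B -> P}).
Local Notation letter := (letter iA iB).
Local Notation word := (word iA iB).
Local Notation Z := (A * B)%type.

Definition wsum s (l : seq (K * seq Z)) : P := \sum_(t <- l) t.1 *: word s t.2.

Definition wspan s n (p : P) : Prop :=
  exists2 l, all (fun t => size t.2 == n) l & p = wsum s l.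

Lemma wspan_lin s n k p q : wspan s n p -> wspan s n q -> wspan s n (k *: p + q).
Proof.
move=> [l1 sz1 ->] [l2 sz2 ->]; exists ([seq (k * t.1, t.2) | t <- l1] ++ l2).
  by rewrite all_cat all_map sz2 andbT.
rewrite /wsum big_cat big_map scaler_sumr; congr (_ + _).
by apply: eq_bigr => t _; rewrite scalerA.
Qed.

Lemma wspan0 s n : wspan s n 0.
Proof. by exists [::]; rewrite // /wsum big_nil. Qed.

Lemma wspanD s n p q : wspan s n p -> wspan s n q -> wspan s n (p + q).
Proof. by move=> sp sq; rewrite -[p]scale1r; apply: wspan_lin. Qed.

Lemma wspanZ s n k p : wspan s n p -> wspan s n (k *: p).
Proof. by move=> sp; rewrite -[_ *: _]addr0; apply: wspan_lin (wspan0 _ _). Qed.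

Lemma wspan_sum s n (I : Type) (r : seq I) (F : I -> P) :
  (forall i, wspan s n (F i)) -> wspan s n (\sum_(i <- r) F i).
Proof. by move=> sF; elim/big_ind: _ => //; [apply: wspan0 | apply: wspanD]. Qed.

Lemma wspan_word s w : wspan s (size w) (word s w).
Proof. by exists [:: (1, w)]; rewrite /= ?eqxx // /wsum big_seq1 scale1r. Qed.

Lemma wspan_ind s n (X : P -> Prop) :
    X 0 -> (forall k p q, X p -> X q -> X (k *: p + q)) ->
    (forall w, size w = n -> X (word s w)) ->
  forall p, wspan s n p -> X p.
Proof.
move=> X0 XL Xw p [l szl ->]; elim: l szl => [|t l IHl] /=; rewrite /wsum.
  by rewrite big_nil.
by rewrite big_cons => /andP[/eqP szt /IHl]; apply: XL; apply: Xw.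
Qed.

Lemma letter11 s : letter s (1, 1) = 1.
Proof. by case: s; rewrite /letter /= rmorph1. Qed.

Lemma letterM s (y z : Z) : letter s y * letter s z = letter s (y.1 * z.1, y.2 * z.2).
Proof. by case: s; rewrite /letter /= rmorphM. Qed.

Lemma word_cat s u v : word s (u ++ v) = word s u * word (s (+) odd (size u)) v.
Proof.
elim: u s => [|z u IHu] s /=; first by rewrite addbF mul1r.
by rewrite IHu mulrA addNb addbN.
Qed.

(** A final letter [1] lengthens a word without changing its value. *)
Lemma wspanS s n p : wspan s n p -> wspan s n.+1 p.
Proof.
apply: wspan_ind => [|k x y|w <-]; [exact: wspan0 | exact: wspan_lin |].
have -> : word s w = word s (rcons w (1, 1)).
  by rewrite -cats1 word_cat /= letter11 !mulr1.
by rewrite -(size_rcons w (1, 1)); apply: wspan_word.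
Qed.

Lemma wspan_leq s m n p : (m <= n)%N -> wspan s m p -> wspan s n p.
Proof.
move=> /subnKC <- sp; elim: (n - m)%N => [|k IHk]; first by rewrite addn0.
by rewrite addnS; apply: wspanS.
Qed.

Lemma wspanM s m n p q : wspan s m p -> wspan (s (+) odd m) n q -> wspan s (m + n)%N (p * q).
Proof.
move=> sp sq; move: p sp; apply: wspan_ind => [|k x y sx sy|u um].
- by rewrite mul0r; apply: wspan0.
- by rewrite mulrDl -scalerAl; apply: wspan_lin.
move: q sq; apply: wspan_ind => [|k x y sx sy|v vn].
- by rewrite mulr0; apply: wspan0.
- by rewrite mulrDr -scalerAr; apply: wspan_lin.
by rewrite -um -word_cat -vn -size_cat; apply: wspan_word.
Qed.

Lemma wspan_letter s z : wspan s 1 (letter s z).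
Proof. by have := wspan_word s [:: z]; rewrite /= mulr1. Qed.

(** The new letter merges with the first one, which is on the same side; only the empty word really
    grows. *)
Lemma wspan_absorb s n z p : wspan s n p -> wspan s n.+1 (letter s z * p).
Proof.
move: p; apply: wspan_ind => [|k x y sx sy|[|y w] <-].
- by rewrite mulr0; apply: wspan0.
- by rewrite mulrDr -scalerAr; apply: wspan_lin.
- by rewrite mulr1; apply: wspan_letter.
rewrite /= mulrA letterM; apply: wspanS.
exact: (wspan_word s ((z.1 * y.1, z.2 * y.2) :: w)).
Qed.

Hypothesis freeP : is_free_product iA iB.

(** Words of even length concatenate without breaking the alternation, so they span a subalgebra; it
    contains both factors. *)
Lemma wspan_all p : exists n, wspan true n.*2 p.
Proof.
pose S : {pred P} := fun q => `[< exists n, wspan true n.*2 q >].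
suff /asboolP : p \in S by [].
apply: (free_product_gen freeP) => [|a|b].
- split=> [|k x y /asboolP[m sx] /asboolP[n sy]|
           x y /asboolP[m sx] /asboolP[n sy]]; apply/asboolP.
  + by exists 0%N; apply: (wspan_word true [::]).
  + exists (maxn m n); apply: wspan_lin; apply: wspan_leq; try eassumption.
      by rewrite leq_double leq_maxl.
    by rewrite leq_double leq_maxr.
  by exists (m + n)%N; rewrite doubleD; apply: wspanM; rewrite ?odd_double.
- by apply/asboolP; exists 1%N; apply: wspanS; apply: (wspan_letter true (a, 0)).
apply/asboolP; exists 1%N; have := wspan_word true [:: (1, 1); (0, b)].
by rewrite /= /letter /= rmorph1 mul1r mulr1.
Qed.

End Words.

(** * Elements without traces *)

Section FreeProductOfRFD.
Variables (K : fieldType) (charK0 : [pchar K] =i pred0).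
Variables (A B P : algType K).
Variables (iA : {lrmorphism A -> P}) (iB : {lrmorphism B -> P}).
Hypothesis freeP : is_free_product iA iB.
Hypotheses (rfdA : RFD A) (rfdB : RFD B).
Local Notation letter := (letter iA iB).
Local Notation word := (word iA iB).
Local Notation wsum := (wsum iA iB).
Local Notation wspan := (wspan iA iB).
Local Notation Z := (A * B)%type.

Definition rep_null (p : P) := forall d (f : P -> 'M[K]_d), mrep id f -> f p = 0.

Definition lsum (l : seq (K * seq Z)) (F : seq Z -> K) : K := \sum_(t <- l) t.1 * F t.2.

(** Every specialization of ['X] is a representation over [K], and [poly_fun0] passes from all
    specializations to the polynomial entries. *)
Lemma mrep_poly_null d (h : P -> 'M[{poly K}]_d) p :
  mrep (fun c => c%:A) h -> rep_null p -> h p = 0.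
Proof.
move=> rh p0; apply/matrixP=> i j; rewrite mxE; apply: (poly_fun0 charK0) => t.
by have := p0 _ _ (mrep_horner t rh) => /matrixP/(_ i j); rewrite !mxE.
Qed.

Lemma mrep_wsum d (h : P -> 'M[{poly K}]_d) s l :
  mrep (fun c => c%:A) h -> h (wsum s l) = \sum_(t <- l) t.1%:P *: h (word s t.2).
Proof.
move=> rh; have sc1 : 1%:A = 1 :> {poly K} by rewrite scale1r.
rewrite (mrep_sum sc1 rh); apply: eq_bigr => t _.
by rewrite (mrepZ sc1 rh) alg_polyC.
Qed.

(** The chosen entry of the path family vanishes on words begun on [~~ s], so in the coefficient of
    degree [n] it discards [l'] and reads [lsum l (wval f)] up to sign. *)
Lemma rep_null_wval s n l l' f :
    all (fun t => size t.2 == n.+1) l -> all (fun t => size t.2 == n.+1) l' ->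
    rep_null (wsum s l + wsum (~~ s) l') -> alternating s f ->
  lsum l (wval f) = 0.
Proof.
move=> szl szl' p0 altf.
have [r [ell [i [j [rell wf w0]]]]] := realizable_path rfdA rfdB n.+1 altf.
have [d [h [Q [U [rh QU hw _]]]]] := deformed_rep freeP rell.
have sc1 : 1%:A = 1 :> {poly K} by rewrite scale1r.
have top s' m : all (fun t => size t.2 == n.+1) m ->
    mxtop n (Q *m h (wsum s' m) *m U)
      (\sum_(t <- m) t.1 *: (wsign K s' n *: wprod ell s' t.2)).
  move=> /allP szm; rewrite mrep_wsum // mulmx_sumr mulmx_suml.
  under eq_bigr do rewrite -scalemxAr -scalemxAl.
  apply: mxtop_sum => -[k [|z w]] /szm //= /eqP[<-]; exact: hw.
have := mxtop_lin 1 (top s l szl) (top (~~ s) l' szl').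
rewrite !scale1r -mulmxDl -mulmxDr -(mrepD sc1 rh) (mrep_poly_null rh p0).
rewrite mulmx0 mul0mx => /mxtop_inj/matrixP/(_ i j); rewrite mxE !summxE mxE.
rewrite [X in _ + X = _]big1_seq => [|[k [|z w]] /andP[_ /(allP szl')] // _]; last first.
  by rewrite mxE [(_ *: wprod _ _ _) _ _]mxE w0 !mulr0.
rewrite addr0 => sum0; apply: (mulfI (wsign_neq0 K s n)); rewrite mulr0 -[RHS]sum0.
rewrite mulr_sumr; apply: eq_big_seq => t /(allP szl)/eqP szt.
by rewrite mxE [(_ *: wprod _ _ _) _ _]mxE wf // mulrCA.
Qed.

(** Under the trace a word has as many deformation factors as letters, hence the coefficient of
    degree [n.+1.*2]. *)
Lemma trace_null_wval n l f :
    all (fun t => size t.2 == n.+1.*2) l -> trace_null (wsum true l) ->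
    alternating true f ->
  lsum l (fun w => \sum_(i < n.+1.*2) (~~ odd i)%:R * wval f (rotr i w)) = 0.
Proof.
move=> szl p0 altf.
have [r [ell [rell tr]]] := realizable_cycle_trace rfdA rfdB n.+1 altf.
have [d [h [Q [U [rh QU _ htr]]]]] := deformed_rep freeP rell.
have trh0 : \tr (h (wsum true l)) = 0.
  apply: (poly_fun0 charK0) => t; have := p0 _ _ (mrep_horner t rh).
  by rewrite -horner_evalE -trace_map_mx.
have trS : \tr (h (wsum true l)) = \sum_(t <- l) t.1%:P * \tr (h (word true t.2)).
  by rewrite mrep_wsum // linear_sum; apply: eq_bigr => t _; apply: mxtraceZ.
move/(congr1 (fun q : {poly K} => q`_(n.+1.*2))): trh0.
rewrite trS coef_sum coef0 => sum0.
apply: (mulfI (wsign_neq0 K true n.+1.*2)); rewrite mulr0 -[RHS]sum0 mulr_sumr.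
apply: eq_big_seq => -[k [|z w]] /(allP szl) // /eqP szw.
have {}szw : (size w).+1 = n.+1.*2 := szw.
have ow : odd (size w) by have [->] := szw; rewrite /= odd_double.
have := htr true z w ow; rewrite szw coefCM => ->; rewrite mulrCA.
by rewrite -tr.
Qed.

(** * Reduction to shorter words *)

Lemma letter_decomp s (l : seq Z) :
  exists (r : seq ({phi : Z -> K | side_fun s phi} * Z)) (e : Z -> K),
    forall z, z \in l ->
      letter s z = \sum_(t <- r) sval t.1 z *: letter s t.2 + (e z)%:A.
Proof.
suff [r rE] : exists r : seq ({phi : Z -> K | side_fun s phi} * Z), forall z, z \in l ->
    exists k, letter s z = \sum_(t <- r) sval t.1 z *: letter s t.2 + k%:A.
  have /choice[e eE] : forall z, exists k, z \in l ->
      letter s z = \sum_(t <- r) sval t.1 z *: letter s t.2 + k%:A.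
    by move=> z; case: (boolP (z \in l)) => [/rE[k zE]|_]; [exists k | exists 0].
  by exists r, e.
case: s.
  have [r rE] := coef_fun_decomp charK0 rfdA [seq z.1 | z <- l].
  have sf (lam : {lam : A -> K | coef_fun lam}) : @side_fun K A B true (sval lam \o fst).
    by exists (sval lam) => //; apply: svalP.
  exists [seq (exist _ _ (sf t.1), (t.2, 0)) | t <- r] => z zl.
  have [k zE] := rE _ (map_f fst zl); exists k.
  rewrite /letter {1}zE linearD linear_sum linearZ /= rmorph1 big_map.
  by congr (_ + _); apply: eq_bigr => t _; rewrite linearZ.
have [r rE] := coef_fun_decomp charK0 rfdB [seq z.2 | z <- l].
have sf (lam : {lam : B -> K | coef_fun lam}) : @side_fun K A B false (sval lam \o snd).
  by exists (sval lam) => //; apply: svalP.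
exists [seq (exist _ _ (sf t.1), (0, t.2)) | t <- r] => z zl.
have [k zE] := rE _ (map_f snd zl); exists k.
rewrite /letter {1}zE linearD linear_sum linearZ /= rmorph1 big_map.
by congr (_ + _); apply: eq_bigr => t _; rewrite linearZ.
Qed.

(** Both starting sides occur because a first letter replaced by a scalar exposes the other side.
    Nothing is shorter than the empty word, hence [p = 0] at length 0. *)
Definition lower s n (p : P) : Prop :=
  if n is n'.+1 then exists p1 p2, [/\ wspan s n' p1, wspan (~~ s) n' p2 & p = p1 + p2]
  else p = 0.

Lemma lower_letter s n z p : lower (~~ s) n p -> wspan s n (letter s z * p).
Proof.
case: n => [|n] /=; first by move=> ->; rewrite mulr0; apply: wspan0.
move=> [p1 [p2 [sp1 + ->]]]; rewrite negbK mulrDr => sp2; apply: wspanD.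
  by rewrite -add1n; apply: wspanM; [apply: wspan_letter | rewrite addbT].
exact: wspan_absorb.
Qed.

Lemma alternating0 s : alternating s (fun _ (_ : Z) => 0 : K).
Proof.
by move=> k; rewrite /side_fun; case: ifP => _; exists (fun=> 0) => //; apply: coef_fun0.
Qed.

(* If the element of [C_s / K (x) C_(~~ s) / K (x) ...] given by [l] is killed by
   all products of coefficient functionals, then it vanishes, so that expanding
   the first letters leaves shorter words only. *)
Lemma wsum_lower s n l :
    all (fun t => size t.2 == n) l ->
    (forall f, alternating s f -> lsum l (wval f) = 0) ->
  lower s n (wsum s l).
Proof.
elim: n s l => [|n IHn] s l szl l0 /=.
  (* On empty words [wval] is 1, so [wsum] is the scalar [lsum]. *)
  have := l0 _ (alternating0 s); rewrite /wsum => /(congr1 (fun k => k *: (1 : P))).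
  rewrite scale0r scaler_suml => sum0; rewrite -[RHS]sum0.
  by apply: eq_big_seq => -[k [|z w]] /(allP szl) //= _; rewrite mulr1.
(* The default is never reached: all words have length [n.+1]. *)
pose hd (t : K * seq Z) := head (0, 0) t.2.
have [r [e rE]] := letter_decomp s [seq hd t | t <- l].
(* [li u] gathers what follows the expanding letter of [u]; [lk] gathers the scalar parts, which
   leave words one letter shorter on the other side. *)
pose li (u : {phi | side_fun s phi} * Z) := [seq (t.1 * sval u.1 (hd t), behead t.2) | t <- l].
pose lk := [seq (t.1 * e (hd t), behead t.2) | t <- l].
have szli (c : K * seq Z -> K) :
    all (fun t => size t.2 == n) [seq (c t, behead t.2) | t <- l].
  by rewrite all_map; apply: sub_all szl => t /= /eqP szt; rewrite size_behead szt.
exists (\sum_(u <- r) letter s u.2 * wsum (~~ s) (li u)), (wsum (~~ s) lk); split.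
- apply: wspan_sum => u; apply: lower_letter; apply: IHn => [|f altf]; first exact: szli.
  (* Prepending the functional of [u] reduces the premise for [li u] to the one for [l]. *)
  pose f' k := if k is k'.+1 then f k' else sval u.1.
  have altf' : alternating s f'.
    move=> [|k] /=; first by rewrite addbF; apply: svalP.
    by have := altf k; rewrite addNb addbN.
  rewrite -[RHS](l0 _ altf') /lsum big_map; apply: eq_big_seq => -[k [|z w]] /(allP szl) //= _.
  by rewrite mulrA.
- by exists lk => //; apply: szli.
rewrite /wsum (big_map (fun t => (t.1 * e (hd t), behead t.2))) /=.
under [X in _ = X + _]eq_bigr do rewrite big_map mulr_sumr.
rewrite exchange_big -big_split; apply: eq_big_seq => t tl /=.
have := rE _ (map_f hd tl); have := allP szl t tl.
case: t {tl} => k [|z w] //= _; rewrite /hd /= => ->.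
rewrite mulrDl mulr_suml scalerDr scaler_sumr; congr (_ + _).
  by apply: eq_bigr => u _; rewrite -scalerAl scalerA scalerAr.
by rewrite -scalerAl mul1r scalerA.
Qed.

(** * Residual finite-dimensionality of the free product *)

Lemma free_product_mrep_const d (al : A -> 'M[K]_d) (be : B -> 'M[K]_d) :
    mrep id al -> mrep id be ->
  exists2 h : P -> 'M[K]_d, mrep id h &
    (forall a, h (iA a) = al a) /\ (forall b, h (iB b) = be b).
Proof.
(* Constant polynomials put the entries in an algebra over [K]; evaluation at 0 brings them back. *)
have lift (C : algType K) (f : C -> 'M[K]_d) : mrep id f ->
    mrep (fun c => c%:A) (fun c => map_mx polyC (f c)).
  move=> [fL f1 fM]; split=> [k x y||x y].
  - by rewrite fL map_mxD map_mxZ /= alg_polyC.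
  - by rewrite f1 map_mx1.
  by rewrite fM map_mxM.
move=> ra rb; have [h rh [hA hB]] := free_product_mrep freeP (lift _ _ ra) (lift _ _ rb).
exists (fun p => map_mx (horner_eval 0) (h p)); first exact: mrep_horner.
by split=> x; rewrite ?hA ?hB; apply/matrixP=> i j; rewrite !mxE /horner_eval hornerC.
Qed.

Lemma free_product_tens d1 d2 (al : A -> 'M[K]_d1) (be : B -> 'M[K]_d2) :
    mrep id al -> mrep id be ->
  exists2 h : P -> 'M[K]_(d1 * d2), mrep id h &
    (forall a, h (iA a) = al a *t 1%:M) /\ (forall b, h (iB b) = 1%:M *t be b).
Proof.
by move=> ra rb; apply: free_product_mrep_const; [apply: mrep_tensl|apply: mrep_tensr].
Qed.

(** [rep_null_wval] and [wsum_lower] shorten each part; regrouping by starting side allows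
    induction. At length 0 a scalar is left, which any nonzero representation detects. *)
Lemma rep_null_eq0 n p1 p2 :
  wspan true n p1 -> wspan false n p2 -> rep_null (p1 + p2) -> p1 + p2 = 0.
Proof.
elim: n p1 p2 => [|n IHn] p1 p2.
  have scal s p : wspan s 0 p -> exists k, p = k%:A.
    move: p; apply: wspan_ind => [|k x y [i ->] [j ->]|[|//] _].
    - by exists 0; rewrite scale0r.
    - by exists (k * i + j); rewrite scalerDl scalerA.
    by exists 1; rewrite scale1r.
  move=> /scal[k ->] /scal[l ->]; rewrite -scalerDl => p0.
  have [d1 [al [d10 ra]]] := RFD_mrep rfdA; have [d2 [be [d20 rb]]] := RFD_mrep rfdB.
  have [h rh _] := free_product_tens ra rb.
  have [_ h1 _] := rh.
  have d0 : (0 < d1 * d2)%N by rewrite muln_gt0 d10.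
  have := p0 _ _ rh; rewrite (mrepZ _ rh) // h1 => /matrixP/(_ (Ordinal d0) (Ordinal d0)).
  by rewrite !mxE eqxx mulr1 => ->; rewrite scale0r.
move=> [l1 sz1 ->] [l2 sz2 ->] p0.
have [|q1 [q2 [sq1 sq2 qE]]] := @wsum_lower true n.+1 l1 sz1.
  by move=> f altf; apply: (@rep_null_wval true n l1 l2).
have [|r1 [r2 [sr1 sr2 rE]]] := @wsum_lower false n.+1 l2 sz2.
  by move=> f altf; apply: (@rep_null_wval false n l2 l1) => //; rewrite addrC.
move: p0; rewrite qE rE [r1 + r2]addrC addrACA; apply: IHn; exact: wspanD.
Qed.

Lemma free_product_RFD : RFD P.
Proof.
apply/(RFDP charK0) => p p0; have [n sp] := wspan_all freeP p.
by rewrite -[p]addr0; apply: rep_null_eq0 sp (wspan0 _ _ _ _) _; rewrite addr0.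
Qed.

(** * Congruence modulo commutators *)

Definition comm_eq (C : algType K) (x y : C) : Prop := x - y \in comm_space C.

Lemma comm_eq_refl (C : algType K) (x : C) : comm_eq x x.
Proof. by rewrite /comm_eq subrr; apply: comm_space0. Qed.

Lemma comm_eq_lin (C : algType K) k (x y x' y' : C) :
  comm_eq x x' -> comm_eq y y' -> comm_eq (k *: x + y) (k *: x' + y').
Proof.
by move=> xx' yy'; rewrite /comm_eq opprD addrACA -scalerBr; apply: comm_spaceZD.
Qed.

Lemma comm_eqD (C : algType K) (x y x' y' : C) :
  comm_eq x x' -> comm_eq y y' -> comm_eq (x + y) (x' + y').
Proof. by move=> xx' yy'; rewrite -[x]scale1r -[x']scale1r; apply: comm_eq_lin. Qed.

Lemma comm_eq_sum (C : algType K) (I : eqType) (r : seq I) (F G : I -> C) :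
  (forall i, i \in r -> comm_eq (F i) (G i)) ->
  comm_eq (\sum_(i <- r) F i) (\sum_(i <- r) G i).
Proof.
move=> FG; rewrite big_seq [X in comm_eq _ X]big_seq.
by elim/big_rec2: _ => [|i x y ir xy]; [apply: comm_eq_refl | apply: comm_eqD xy; apply: FG].
Qed.

Lemma comm_eq_trans (C : algType K) (x y z : C) :
  comm_eq x y -> comm_eq y z -> comm_eq x z.
Proof.
by move=> xy yz; rewrite /comm_eq -[x](subrK y) -addrA -[_ - y]scale1r; apply: comm_spaceZD.
Qed.

Lemma comm_eq_sym (C : algType K) (x y : C) : comm_eq x y -> comm_eq y x.
Proof. by move=> /(comm_spaceZ (-1)); rewrite scaleN1r opprB. Qed.

Lemma comm_eq0 (C : algType K) (x y : C) :
  comm_eq x y -> y \in comm_space C -> x \in comm_space C.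
Proof.
by move=> xy y0; rewrite -[x](subrK y) -[_ - y]scale1r; apply: comm_spaceZD.
Qed.

Lemma comm_eq_trace_null (C : algType K) (x y : C) :
  comm_eq x y -> trace_null x -> trace_null y.
Proof.
move=> /trace_null_comm xy x0 d f rf; have /eqP := xy _ _ rf.
by rewrite (mrepB _ rf) // linearB /= x0 // sub0r oppr_eq0 => /eqP.
Qed.

Lemma comm_space_morph (C D : algType K) (i : {lrmorphism C -> D}) x :
  x \in comm_space C -> i x \in comm_space D.
Proof.
move=> /comm_spaceP[s ->]; apply/comm_spaceP.
exists [seq (t.1, (i t.2.1, i t.2.2)) | t <- s].
rewrite linear_sum big_map; apply: eq_bigr => t _.
by rewrite linearZ /commutator linearB /= !rmorphM.
Qed.

(** * Traces and the cocenter of the free product *)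

Hypotheses (trA : forall a : A, trace_null a -> a \in comm_space A).
Hypotheses (trB : forall b : B, trace_null b -> b \in comm_space B).

(* On [V (x) W] the trace of [iA a + iB b] is [dim W tr_V a + dim V tr_W b], so its
   vanishing makes the normalized traces of [a] and [- b] the same constant. *)
Lemma trace_null_factors a b :
  trace_null (iA a + iB b) -> iA a + iB b \in comm_space P.
Proof.
move=> ab0.
have tr0 d1 d2 (al : A -> 'M[K]_d1) (be : B -> 'M[K]_d2) : mrep id al -> mrep id be ->
    d2%:R * \tr (al a) + d1%:R * \tr (be b) = 0.
  move=> ra rb; have [h rh [hA hB]] := free_product_tens ra rb.
  have := ab0 _ _ rh; rewrite (mrepD _ rh) // hA hB linearD /= !mxtrace_tens !mxtrace1.
  by rewrite mulrC.
have nat0 d : (0 < d)%N -> d%:R != 0 :> K.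
  by move=> d0; rewrite (iffLR (pcharf0P _) charK0) -lt0n.
have [d1 [al [/nat0 d10 ra]]] := RFD_mrep rfdA.
have [d2 [be [/nat0 d20 rb]]] := RFD_mrep rfdB.
pose k := \tr (al a) / d1%:R.
have trb d (f : B -> 'M[K]_d) : mrep id f -> \tr (f b) = - (k * d%:R).
  move=> rf; have := tr0 _ _ _ _ ra rf => /eqP; rewrite addrC addr_eq0 => /eqP trE.
  apply: (mulfI d10); rewrite trE mulrN; congr (- _).
  by rewrite /k mulrAC mulrCA divff // mulr1 mulrC.
have tra d (f : A -> 'M[K]_d) : mrep id f -> \tr (f a) = k * d%:R.
  move=> rf; have := tr0 _ _ _ _ rf rb => /eqP; rewrite trb // addr_eq0 => /eqP trE.
  apply: (mulfI d20); rewrite trE mulrN opprK mulrCA [RHS]mulrCA.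
  by congr (_ * _); apply: mulrC.
(* Moving [k] from [a] to [b] keeps the sum and makes both terms traceless in every
   representation. *)
have -> : iA a + iB b = 1 *: iA (a - k%:A) + iB (b + k%:A).
  rewrite scale1r linearB linearD !linearZ /= !rmorph1 scalerN.
  by rewrite [iB b + _]addrC addrA subrK.
apply: comm_spaceZD; apply: comm_space_morph.
  apply: trA => d f rf; have [_ f1 _] := rf.
  by rewrite (mrepB _ rf) // (mrepZ _ rf) // f1 linearB linearZ /= mxtrace1 tra // subrr.
apply: trB => d f rf; have [_ f1 _] := rf.
by rewrite (mrepD _ rf) // (mrepZ _ rf) // f1 linearD linearZ /= mxtrace1 trb // addNr.
Qed.

Lemma comm_eqC (C : algType K) (x y : C) : comm_eq (x * y) (y * x).
Proof. exact: comm_spaceM. Qed.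

Lemma wspan_comm_ind s n s' n' p :
    (forall w, size w = n -> exists2 q, wspan s' n' q & comm_eq (word s w) q) ->
    wspan s n p ->
  exists2 q, wspan s' n' q & comm_eq p q.
Proof.
move=> hw; move: p; apply: wspan_ind => [|k x y [x' sx xx'] [y' sy yy']|//].
  by exists 0; [apply: wspan0 | apply: comm_eq_refl].
by exists (k *: x' + y'); [apply: wspan_lin | apply: comm_eq_lin].
Qed.

(** In odd length the first and last letters are on the same side, so cycling merges them. A word of
    even length begun in [B] is then turned by one letter to begin in [A]. *)
Lemma wspan_comm_odd s n p :
  wspan s n.+1.*2.+1 p -> exists2 q, wspan true n.+1.*2 q & comm_eq p q.
Proof.
have even_true p' : wspan s n.+1.*2 p' -> exists2 q, wspan true n.+1.*2 q & comm_eq p' q.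
  case: s => sp; first by exists p' => //; apply: comm_eq_refl.
  apply: wspan_comm_ind sp => -[|z w] // szw.
  exists (word true (rcons w z)).
    have <- : size (rcons w z) = n.+1.*2 by rewrite size_rcons.
    exact: wspan_word.
  have -> : word true (rcons w z) = word true w * letter false z.
    have ow : odd (size w) by move: szw => -[->]; rewrite /= odd_double.
    by rewrite -cats1 word_cat ow /= mulr1.
  exact: comm_eqC.
move=> /(wspan_comm_ind (s' := s) (n' := n.+1.*2)) [|q sq pq]; last first.
  have [q' sq' qq'] := even_true _ sq.
  by exists q' => //; apply: comm_eq_trans pq qq'.
move=> [|z w] // szw; case/lastP: w szw => [|w y] // szw.
exists (word s ((y.1 * z.1, y.2 * z.2) :: w)).
  have <- : size ((y.1 * z.1, y.2 * z.2) :: w) = n.+1.*2.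
    by apply/eqP; move/eqP: szw; rewrite /= size_rcons.
  exact: wspan_word.
have -> : word s (z :: rcons w y) = letter s z * word (~~ s) w * letter s y.
  have ow : odd (size w).
    by move/eqP: szw; rewrite /= size_rcons doubleS !eqSS => /eqP->; rewrite /= odd_double.
  by rewrite -[word s _]/(_ * word _ _) -cats1 word_cat ow addbT negbK /= mulr1 mulrA.
by rewrite -[word s (_ :: _)]/(_ * word _ _) -letterM -(mulrA (letter s y)); apply: comm_eqC.
Qed.

(** An even rotation swaps two blocks of even length, both begun on side [true]: the words are
    [x * y] and [y * x]. *)
Lemma word_rotr i w : ~~ odd (size w) -> ~~ odd i -> (i <= size w)%N ->
  comm_eq (word true (rotr i w)) (word true w).
Proof.
move=> evw evi iw; rewrite /rotr /rot.
rewrite -[X in comm_eq _ (word _ X)](cat_take_drop (size w - i) w) !word_cat.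
rewrite size_drop subKn // size_takel ?leq_subr // oddB // (negPf evw) (negPf evi).
exact: comm_eqC.
Qed.

(* The sum of the even rotations of the words of [p] is congruent to [n + 1] times
   [p], and the functionals of [wsum_lower] applied to it are traces of [p]. *)
Lemma trace_null_lower n p : wspan true n.+1.*2 p -> trace_null p ->
  exists q1 q2, [/\ wspan true n.*2.+1 q1, wspan false n.*2.+1 q2 & comm_eq p (q1 + q2)].
Proof.
move=> [l szl ->] p0.
(* Odd rotations are kept with coefficient 0 to match the trace formula term by term. *)
pose l' := [seq (t.1 * (~~ odd i)%:R, rotr i t.2) | t <- l, i <- iota 0 n.+1.*2].
have szl' : all (fun t => size t.2 == n.+1.*2) l'.
  apply/allP=> _ /allpairsP[[t i] /= [tl _ ->]]; rewrite /= size_rotr.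
  exact: (allP szl).
have [|q1 [q2 [sq1 sq2 qE]]] := @wsum_lower true n.+1.*2 l' szl'.
  move=> f altf; rewrite -[RHS](trace_null_wval szl p0 altf) /lsum /l' big_allpairs_dep /=.
  apply: eq_bigr => t _.
  rewrite -(big_mkord xpredT (fun i => (~~ odd i)%:R * wval f (rotr i t.2))).
  rewrite /index_iota subn0 mulr_sumr.
  by apply: eq_bigr => i _; rewrite mulrA.
(* [n.+1] is the number of even rotations, to be divided by. *)
have n0 : n.+1%:R != 0 :> K by rewrite (iffLR (pcharf0P _) charK0).
exists (n.+1%:R^-1 *: q1), (n.+1%:R^-1 *: q2); split; try exact: wspanZ.
rewrite -scalerDr -qE -[X in comm_eq X _](scalerK n0).
rewrite -[_^-1 *: (_ *: _)]addr0 -[_^-1 *: wsum _ _]addr0.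
apply: comm_eq_lin (comm_eq_refl _); apply: comm_eq_sym.
have evens : \sum_(i <- iota 0 n.+1.*2) (~~ odd i)%:R = n.+1%:R :> K.
  elim: n {l szl p0 l' szl' q1 q2 sq1 sq2 qE n0} => [|n IHn].
    by rewrite !big_cons big_nil !addr0.
  rewrite doubleS -addn2 iotaD big_cat IHn /= !big_cons big_nil add0n /=.
  by rewrite odd_double /= !addr0 -natrD addn1.
have -> : wsum true l' = \sum_(t <- l) \sum_(i <- iota 0 n.+1.*2)
    (t.1 * (~~ odd i)%:R) *: word true (rotr i t.2) by rewrite /wsum /l' big_allpairs_dep.
rewrite /wsum scaler_sumr; apply: comm_eq_sum => t tl; have /eqP szt := allP szl t tl.
rewrite -evens scaler_suml; apply: comm_eq_sum => i; rewrite mem_iota add0n => /andP[_ ile].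
case: (boolP (odd i)) => [_|ie]; first by rewrite mulr0 !scale0r; apply: comm_eq_refl.
rewrite mulr1 scale1r -[_ *: word _ _]addr0 -[t.1 *: word _ t.2]addr0.
apply: comm_eq_lin (comm_eq_refl _).
by apply: word_rotr; rewrite ?szt ?odd_double // ltnW.
Qed.

Lemma wspan1_letter s p : wspan s 1 p -> exists z, p = letter s z.
Proof.
move: p; apply: wspan_ind => [|k _ _ [x ->] [y ->]|[|z [|//]] // _].
- by exists (0, 0); case: s; rewrite /letter linear0.
- by exists (k *: x.1 + y.1, k *: x.2 + y.2); case: s; rewrite /letter linearP.
by exists z; rewrite /= mulr1.
Qed.

(** Each round shortens an even length to an odd one by [trace_null_lower], then to the next even
    one by [wspan_comm_odd]; congruence keeps traces null. The descent ends with single letters,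
    where [trace_null_factors] applies. *)
Lemma trace_null_comm_space p : trace_null p -> p \in comm_space P.
Proof.
(* Two letters of padding make the length positive, as [trace_null_lower] requires. *)
have [n /wspanS/wspanS] := wspan_all freeP p; rewrite -doubleS => sp.
elim: n p sp => [|n IHn] p sp p0.
  have [q1 [q2 [/wspan1_letter[y ->] /wspan1_letter[z ->] pq]]] := trace_null_lower sp p0.
  apply: (comm_eq0 pq); apply: trace_null_factors; exact: comm_eq_trace_null pq p0.
have [q1 [q2 [/wspan_comm_odd[r1 sr1 qr1] /wspan_comm_odd[r2 sr2 qr2] pq]]] :=
  trace_null_lower sp p0.
have pr := comm_eq_trans pq (comm_eqD qr1 qr2).
apply: (comm_eq0 pr); apply: IHn; first exact: wspanD.
exact: comm_eq_trace_null pr p0.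
Qed.

End FreeProductOfRFD.

Theorem corollary1p3 (K : fieldType) (charK0 : [pchar K] =i pred0)
    (A B P : algType K)
    (iA : {lrmorphism A -> P}) (iB : {lrmorphism B -> P})
    (freeP : is_free_product iA iB) :
  trace_RFD P <-> trace_RFD A /\ trace_RFD B.
Proof.
split=> [trP|[/(trace_RFDP charK0)[rfdA trA] /(trace_RFDP charK0)[rfdB trB]]].
  have freeP' := @free_product_sym _ _ _ _ _ _ freeP.
  by split; [apply: free_factor_trace_RFD freeP _ | apply: free_factor_trace_RFD freeP' _].
apply/(trace_RFDP charK0); split; first exact: (free_product_RFD charK0 freeP).
exact: (trace_null_comm_space charK0 freeP).
Qed.
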